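(* Let $m\ge2$ be a fixed integer, let $W$ be an $m\times m$ random matrix following the standard Wishart distribution $\mathcal W_m(I_m,d)$, and let $\lambda_1\ge\lambda_2\ge\cdots\ge\lambda_m$ be the ordered eigenvalues of $W$. Then for every constant $C>0$, $$\mathbb P\Big(\min_{1\le k\le m-1}(\lambda_k-\lambda_{k+1})>C\Big)\to1$$ as $d\to\infty$ with $m$ fixed.
   Context: $W\sim\mathcal W_m(I_m,d)$ means that $W$ has the distribution of $\sum_{i=1}^d v_iv_i^T$ with $v_1,\dots,v_d$ i.i.d. random vectors in $\mathbb{R}^m$ following $\mathcal N_m(0,I_m)$. *)

(* Defs.v *)
From HB Require Import structures.
From mathcomp Require Import all_boot all_order all_algebra.
From mathcomp Require Import all_classical all_reals all_analysis.

Set Implicit Arguments.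
Unset Strict Implicit.
Unset Printing Implicit Defensive.

Import Order.TTheory GRing.Theory Num.Theory.
Import numFieldTopology.Exports numFieldNormedType.Exports.

Local Open Scope classical_set_scope.
Local Open Scope ring_scope.

(* Matrices carry the Borel sigma-algebra of the entrywise topology.  *)
HB.instance Definition _ (R : realType) (m n : nat) :=
  isMeasurable.Build (sigma_display (@open 'M[R]_(m, n))) 'M[R]_(m, n)
    (@sigma_algebra0 _ setT (@open 'M[R]_(m, n)))
    (@sigma_algebraC _ (@open 'M[R]_(m, n)))
    (@sigma_algebra_bigcup _ setT (@open 'M[R]_(m, n))).

(* Taking some of the B i to be setT recovers the product rule for every
   subfamily. *)
Definition mutually_independent (R : realType) (d d' : measure_display)
    (T : measurableType d) (T' : measurableType d') (P : probability T R)
    (n : nat) (X : 'I_n -> T -> T') : Prop :=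
  forall B : 'I_n -> set T', (forall i, measurable (B i)) ->
    P (\bigcap_(i in [set: 'I_n]) X i @^-1` B i) =
    (\prod_(i < n) P (X i @^-1` B i))%E.

Definition std_gaussian_vector (R : realType) (d : measure_display)
    (T : measurableType d) (P : probability T R) (m : nat)
    (X : {RV P >-> 'cV[R]_m}) : Prop :=
  mutually_independent P (fun (j : 'I_m) (w : T) => (X w j 0 : R)) /\
  (forall (j : 'I_m) (B : set R), measurable B ->
    P ((fun w => X w j 0) @^-1` B) = normal_prob 0 1 B).

Definition std_wishart (R : realType) (d : measure_display)
    (T : measurableType d) (P : probability T R) (m n : nat)
    (W : {RV P >-> 'M[R]_m}) : Prop :=
  exists (d' : measure_display) (T' : measurableType d')
    (P' : probability T' R) (v : 'I_n -> {RV P' >-> 'cV[R]_m}),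
    [/\ mutually_independent P' v,
        forall i, std_gaussian_vector (v i) &
        forall B : set 'M[R]_m, measurable B ->
          distribution P W B =
          P' [set w | B (\sum_(i < n) v i w *m (v i w)^T)]].

(* Eigenvalues in nonincreasing order, repeated with algebraic multiplicity;
   the empty sequence when the spectrum of A is not contained in R, which never
   happens for symmetric A. *)
Definition eigenvalues (R : realType) (m : nat) (A : 'M[R]_m) : seq R :=
  xget [::] [set s : seq R | sorted >=%R s /\
                             char_poly A = \prod_(a <- s) ('X - a%:P)].

Lemma eigenvaluesE (R : realType) (m : nat) (A : 'M[R]_m) (s : seq R) :
  sorted >=%R s -> char_poly A = \prod_(a <- s) ('X - a%:P) ->
  eigenvalues A = s.
Proof.
move=> sorted_s charA; rewrite /eigenvalues; case: xgetP => [t _ [sorted_t]|].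
  rewrite charA => /esym eq_ts; apply: (sorted_eq _ _ sorted_t sorted_s).
  - exact: ge_trans.
  - exact: ge_anti.
  - exact: prod_XsubC_eq.
by move=> /(_ s) [].
Qed.

(* k is counted from 0. *)
Definition gap (R : realType) (m : nat) (A : 'M[R]_m) (k : nat) : R :=
  (eigenvalues A)`_k - (eigenvalues A)`_k.+1.

(* For 1 < m the initial value gap A 0 is itself one of the terms. *)
Definition min_gap (R : realType) (m : nat) (A : 'M[R]_m) : R :=
  \big[Num.min/gap A 0]_(k < m.-1) gap A k.

(* Main.v *)
Require Import Defs.
From HB Require Import structures.
From mathcomp Require Import all_boot all_order all_algebra.
From mathcomp Require Import all_classical all_reals all_analysis.
From mathcomp Require Import measurable_realfun ring lra.
Import Order.TTheory GRing.Theory Num.Theory.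
Import numFieldTopology.Exports numFieldNormedType.Exports.
Set Implicit Arguments.
Unset Strict Implicit.
Unset Printing Implicit Defensive.
Local Open Scope classical_set_scope.
Local Open Scope ring_scope.

(* The argument is by induction on m, adding one Gaussian column at a time.
   Write the d x (m+1) data matrix as (u | V) with u a fresh Gaussian column, so
   that the Gram matrix is A = V^T V bordered by b = u^T V and c = |u|^2.  If A
   has eigenvalues mu_i with orthonormal eigenvectors y_i and beta_i = b . y_i,
   then by the Schur complement the characteristic polynomial of the bordered
   matrix at x is
     (x - c - sum_i beta_i^2 / (x - mu_i)) * prod_i (x - mu_i).
   Conditionally on V, beta_i is a centred Gaussian of variance mu_i, which is
   about d, so delta d < beta_i^2 < M d with high probability, while
   |c - d| and |mu_i - d| are at most eta d.  When the mu_i are separated by a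
   constant C' that is large compared with C, M, 1/eta, the term
   beta_i^2 / (x - mu_i) dominates the first factor at x = mu_i +- C, which
   therefore changes sign there: the new eigenvalues interlace the mu_i and
   stay at distance at least C from each of them, hence are separated by more
   than C.  Every probability estimate comes from Gaussian integrals of
   exp(-k (x + a . u)^2 / 2) and exp(-k |u|^2 / 2), by Markov's inequality. *)

(** * Matrices with separated eigenvalues *)

(** The eigenvalues are listed explicitly by [mu], not through [eigenvalues], so that the induction
    can pair them with eigenvectors. For C >= 0 the spectrum is forced to be real and simple. *)
Definition spread (R : realType) n (C z t : R) (A : 'M[R]_n) : Prop :=
  exists mu : 'I_n -> R,
    [/\ char_poly A = \prod_i ('X - (mu i)%:P),
        forall i j : 'I_n, (i < j)%N -> mu j + C < mu i &
        forall i, `|mu i - z| < t].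

(** The intermediate value theorem puts a root inside each of n disjoint open intervals, and a monic
    polynomial of degree n is then the product over these roots. *)
Lemma spread_from_sign (R : realType) n (C z t : R) (A : 'M[R]_n)
    (a b : 'I_n -> R) : 0 <= C ->
  (forall i, a i < b i) ->
  (forall i, z - t <= a i) -> (forall i, b i <= z + t) ->
  (forall i j : 'I_n, (i < j)%N -> b j + C <= a i) ->
  (forall i, (char_poly A).[a i] * (char_poly A).[b i] < 0) ->
  spread C z t A.
Proof.
move=> C0 ab za bz ba pab.
have /choice[mu muP] (i : 'I_n) : exists x, [/\ a i < x, x < b i & root (char_poly A) x].
  have [x /andP[ax xb] rx] : exists2 x, a i <= x <= b i & root (char_poly A) x.
    have := pab i; case: (ltrgtP (char_poly A).[a i] 0) => [pa|pa|->].
    - rewrite nmulr_rlt0// => pb; apply: poly_ivt; first exact/ltW/ab.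
      by rewrite !ltW.
    - rewrite pmulr_rlt0// => pb.
      have [||x xab] := @poly_ivt _ (- char_poly A) (a i) (b i).
      + exact/ltW/ab.
      + by rewrite !hornerN oppr_le0 oppr_ge0 !ltW.
      + by rewrite rootN; exists x.
    - by rewrite mul0r ltxx.
  exists x; split=> //; rewrite lt_neqAle ?ax ?xb andbT; apply/eqP => xE.
    by have := pab i; rewrite xE (rootP rx) mul0r ltxx.
  by have := pab i; rewrite -xE (rootP rx) mulr0 ltxx.
have mugap (i j : 'I_n) : (i < j)%N -> mu j + C < mu i.
  move=> ij; have [? ? _] := muP i; have [? ? _] := muP j.
  by have := ba _ _ ij; lra.
have mu_inj : injective mu.
  move=> i j muij; apply/eqP; rewrite -val_eqE /=; apply/negPn/negP.
  by rewrite neq_ltn => /orP[|] /mugap; rewrite muij; lra.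
exists mu; split => //; last first.
  move=> i; rewrite ltr_norml; have [? ? _] := muP i.
  by have := za i; have := bz i => ? ?; apply/andP; split; lra.
rewrite (@all_roots_prod_XsubC _ (char_poly A) [seq mu i | i <- enum 'I_n]).
- by rewrite (monicP (char_poly_monic A)) scale1r big_map big_enum.
- by rewrite size_char_poly size_map size_enum_ord.
- by apply/allP => _ /mapP[i _ ->]; have [] := muP i.
- by rewrite uniq_rootsE map_inj_uniq// enum_uniq.
Qed.

(* With rational end points, [spread] becomes a countable union of sign
   conditions on the characteristic polynomial; this gives measurability. *)
Lemma spread_to_rat_sign (R : realType) n (C z t : R) (A : 'M[R]_n) : 0 <= C ->
  spread C z t A ->
  exists ab : {ffun 'I_n -> rat * rat},
    [/\ forall i, ratr (ab i).1 < ratr (ab i).2 :> R,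
        forall i, z - t <= ratr (ab i).1,
        forall i, ratr (ab i).2 <= z + t,
        forall i j : 'I_n, (i < j)%N -> ratr (ab j).2 + C <= ratr (ab i).1 &
        forall i, (char_poly A).[ratr (ab i).1] * (char_poly A).[ratr (ab i).2] < 0].
Proof.
move=> C0 [mu [charA mugap muz]].
have [e e0 [egap ez]] : exists2 e : R, 0 < e &
    (forall i j : 'I_n, (i < j)%N -> mu j + C + e *+ 2 < mu i) /\
    (forall i, `|mu i - z| + e < t).
  (* The least slack in the strict inequalities, capped at 1; a third of it leaves room to move
     every end point. *)
  pose d1 := \big[Num.min/1]_(p : 'I_n * 'I_n | (p.1 < p.2)%N) (mu p.1 - mu p.2 - C).
  pose d2 := \big[Num.min/1]_i (t - `|mu i - z|).
  have d1_gt0 : 0 < d1.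
    by apply/bigmin_gtP; split=> [|[i j] /= /mugap]; lra.
  have d2_gt0 : 0 < d2.
    by apply/bigmin_gtP; split=> [|i _]; [lra|have := muz i; lra].
  exists (Num.min d1 d2 / 3).
    by rewrite divr_gt0// lt_min d1_gt0.
  have dm : 0 < Num.min d1 d2 by rewrite lt_min d1_gt0.
  split => [i j ij|i].
    have : Num.min d1 d2 <= mu i - mu j - C.
      rewrite ge_min; apply/orP; left.
      exact: (@bigmin_le_cond _ _ _ 1 (i, j) (fun p => (p.1 < p.2)%N)
        (fun p => mu p.1 - mu p.2 - C)).
    lra.
  have : Num.min d1 d2 <= t - `|mu i - z|.
    rewrite ge_min; apply/orP; right.
    exact: (@bigmin_le_cond _ _ _ 1 i xpredT (fun i => t - `|mu i - z|)).
  lra.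
have /choice[ab abP] (i : 'I_n) : exists ab : rat * rat,
    [/\ mu i - e < ratr ab.1, ratr ab.1 < mu i, mu i < ratr ab.2 & ratr ab.2 < mu i + e].
  have [q1] : exists q : rat, ratr q \in `]mu i - e, mu i[ by apply: rat_in_itvoo; lra.
  have [q2] : exists q : rat, ratr q \in `]mu i, mu i + e[ by apply: rat_in_itvoo; lra.
  by rewrite !in_itv /= => /andP[? ?] /andP[? ?]; exists (q1, q2).
exists (finfun ab); split => [i|i|i|i j ij|i]; rewrite ?ffunE.
- by have [] := abP i; lra.
- by have [? _ _ _] := abP i; have := ez i; have := ler_norm (z - mu i); rewrite distrC; lra.
- by have [_ _ _ ?] := abP i; have := ez i; have := ler_norm (mu i - z); lra.
- by have [? _ _ _] := abP i; have [_ _ _ ?] := abP j; have := egap _ _ ij; lra.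
(* Between the two end points only the factor of mu_i changes sign. *)
- rewrite charA !horner_prod -big_split /=.
  rewrite (bigD1 i)//= !hornerE; have [? ? ? ?] := abP i.
  rewrite pmulr_llt0; first by rewrite nmulr_rlt0; lra.
  apply: prodr_gt0 => j ji; rewrite !hornerE.
  have : (i < j)%N || (j < i)%N by rewrite -neq_ltn eq_sym.
  by case/orP => /egap ?; [rewrite pmulr_rgt0|rewrite nmulr_rgt0]; lra.
Qed.

(** * Characteristic polynomial of a bordered symmetric matrix *)

Lemma horner_char_poly (R : comNzRingType) n (A : 'M[R]_n) (x : R) :
  (char_poly A).[x] = \det (x%:M - A).
Proof.
rewrite /char_poly -horner_evalE -det_map_mx; congr (\det _).
apply/matrixP => i j; rewrite !mxE /= /horner_eval hornerD hornerN hornerMn hornerX hornerC.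
by [].
Qed.

(** Schur complement: right multiplication by the unipotent [L] clears the lower left block and
    leaves a block upper triangular matrix. *)
Lemma det_bordered (R : comUnitRingType) n (a : R) (u : 'rV[R]_n) (v : 'cV[R]_n)
    (D E : 'M[R]_n) : D *m E = 1%:M ->
  \det (block_mx a%:M u v D : 'M[R]_(1 + n)) = (a - (u *m E *m v) 0 0) * \det D.
Proof.
move=> DE; pose L : 'M[R]_(1 + n) := block_mx 1%:M 0 (- (E *m v)) 1%:M.
have detL : \det L = 1 by rewrite det_lblock !det1 mulr1.
rewrite -[LHS]mulr1 -detL -det_mulmx /L mulmx_block.
rewrite !mulmx1 !mulmx0 !add0r !mulmxN !mulmxA DE mul1mx subrr.
by rewrite det_ublock det_mx11 !mxE eqxx mulr1n.
Qed.

(** As the [mu i] are distinct, symmetry makes eigenvectors orthogonal: mu_i <v_i, v_j> = <v_i A,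
    v_j> = mu_j <v_i, v_j>. It remains to normalise them. *)
Lemma symmetric_eigenbasis (R : rcfType) n (A : 'M[R]_n) (mu : 'I_n -> R) :
  A^T = A -> injective mu -> char_poly A = \prod_i ('X - (mu i)%:P) ->
  exists2 O : 'M[R]_n, O *m O^T = 1%:M &
    forall i, row i O *m A = mu i *: row i O.
Proof.
move=> symA mu_inj charA.
have norm2E (v : 'rV[R]_n) : (v *m v^T) 0 0 = \sum_j v 0 j ^+ 2.
  by rewrite mxE; apply: eq_bigr => j _; rewrite mxE.
have /choice[v vP] (i : 'I_n) : exists v : 'rV[R]_n,
    v *m A = mu i *: v /\ (v *m v^T) 0 0 = 1.
  have : root (char_poly A) (mu i).
    rewrite charA /root horner_prod (bigD1 i)//= !hornerE subrr mul0r //.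
  rewrite -eigenvalue_root_char => /eigenvalueP[v vA v0].
  have v_gt0 : 0 < (v *m v^T) 0 0.
    rewrite norm2E lt_neqAle sumr_ge0 ?andbT; last by move=> *; exact: sqr_ge0.
    rewrite eq_sym; apply: contra v0.
    rewrite psumr_eq0; last by move=> *; exact: sqr_ge0.
    move=> /allP v0; apply/eqP/rowP => j; rewrite mxE; apply/eqP.
    by rewrite -sqrf_eq0; apply: v0; rewrite mem_index_enum.
  exists ((Num.sqrt ((v *m v^T) 0 0))^-1 *: v).
  rewrite -scalemxAl vA !scalerA mulrC; split=> //.
  rewrite linearZ /= -scalemxAr -scalemxAl scalerA mxE -invfM -expr2.
  by rewrite sqr_sqrtr ?mulVf ?gt_eqF// ltW.
exists (\matrix_i v i) => [|i]; last by rewrite rowK; have [] := vP i.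
apply/matrixP => i j; rewrite !mxE.
transitivity ((v i *m (v j)^T) 0 0).
  by rewrite mxE; apply: eq_bigr => k _; rewrite !mxE.
have [vi vi1] := vP i; have [vj vj1] := vP j.
have [<-|ij] := eqVneq i j; first by rewrite vi1.
have : mu i *: (v i *m (v j)^T) = mu j *: (v i *m (v j)^T).
  by rewrite scalemxAl -vi scalemxAr -linearZ /= -vj trmx_mul symA mulmxA.
move=> /matrixP/(_ 0 0); rewrite !mxE => /eqP.
by rewrite -subr_eq0 -mulrBl mulf_eq0 subr_eq0 (inj_eq mu_inj) (negbTE ij) /= => /eqP.
Qed.

(** Schur complement of x - A. In the eigenbasis the inverse of x - A is the diagonal matrix [F],
    and the quadratic form in b becomes a sum over the poles mu_i. *)
Lemma horner_char_poly_bordered (R : fieldType) n (A O : 'M[R]_n) (b : 'rV[R]_n)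
    (c x : R) (mu : 'I_n -> R) :
  O *m O^T = 1%:M -> (forall i, row i O *m A = mu i *: row i O) ->
  (forall i, x != mu i) ->
  (char_poly (block_mx c%:M b b^T A : 'M[R]_(1 + n))).[x] =
  (x - c - \sum_i (b *m O^T) 0 i ^+ 2 / (x - mu i)) * (char_poly A).[x].
Proof.
move=> OO OA xmu; have OO' := mulmx1C OO.
rewrite !horner_char_poly.
have -> : (x%:M - block_mx c%:M b b^T A : 'M[R]_(1 + n)) =
    block_mx (x - c)%:M (- b) (- b^T) (x%:M - A).
  rewrite (@scalar_mx_block _ 1 n) opp_block_mx add_block_mx !add0r.
  by rewrite -raddfB.
have OAE : O *m A = diag_mx (\row_i mu i) *m O.
  by apply/row_matrixP => i; rewrite !row_mul OA row_diag_mx -scalemxAl -rowE mxE.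
pose F := diag_mx (\row_i (x - mu i)^-1).
rewrite (@det_bordered _ _ _ _ _ _ (O^T *m F *m O)); last first.
  have -> : x%:M - A = O^T *m (diag_mx (\row_i (x - mu i))) *m O.
    have -> : diag_mx (\row_i (x - mu i)) = x%:M - diag_mx (\row_i mu i) :> 'M[R]_n.
      by apply/matrixP => i j; rewrite !mxE; case: eqP => _; rewrite ?mulr1n ?mulr0n ?subrr.
    rewrite mulmxBr mulmxBl -(mulmxA _ (diag_mx _)) -OAE mulmxA OO' mul1mx.
    by rewrite mul_mx_scalar -scalemxAl OO' scalemx1.
  rewrite !mulmxA -(mulmxA _ O O^T) OO mulmx1 -(mulmxA O^T).
  have -> : diag_mx (\row_i (x - mu i)) *m F = 1%:M.
    rewrite mulmx_diag; apply/matrixP => i j; rewrite !mxE mulfV// subr_eq0//.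
  by rewrite mulmx1.
congr (_ * _); congr (_ - _).
rewrite mulNmx mulmxN mulNmx opprK !mulmxA -(mulmxA _ O b^T).
have -> : O *m b^T = (b *m O^T)^T by rewrite trmx_mul trmxK.
rewrite mxE; apply: eq_bigr => i _.
by rewrite mul_mx_diag !mxE mulrAC expr2.
Qed.

(** Used with [y j] the difference x - mu_j: poles far from the evaluation point contribute
    little. *)
Lemma norm_sum_sqr_div (R : realFieldType) n (P : pred 'I_n) (beta y : 'I_n -> R) (e : R) :
  0 < e -> (forall j, P j -> e <= `|y j|) ->
  `|\sum_(j | P j) beta j ^+ 2 / y j| <= (\sum_j beta j ^+ 2) / e.
Proof.
move=> e0 ey; apply: le_trans (ler_norm_sum _ _ _) _.
apply: (@le_trans _ _ (\sum_(j | P j) beta j ^+ 2 / e)).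
  apply: ler_sum => j Pj; rewrite normrM normfV ger0_norm ?sqr_ge0//.
  by rewrite ler_wpM2l ?sqr_ge0// lef_pV2 ?ey// posrE// (lt_le_trans e0) ?ey.
rewrite -mulr_suml ler_pM2r ?invr_gt0// [leRHS](bigID P) /=.
by rewrite lerDl sumr_ge0// => j _; exact: sqr_ge0.
Qed.

(* The [i]-th new eigenvalue is located in ]mu_i + C, mu_(i-1) - C[, with
   z + 2t and z - 2t as outermost end points. *)
Lemma spread_bordered (R : realType) n (A O : 'M[R]_n) (mu : 'I_n -> R)
    (b : 'rV[R]_n) (c C C' z t : R) (beta : 'I_n -> R := fun i => (b *m O^T) 0 i) :
  O *m O^T = 1%:M -> (forall i, row i O *m A = mu i *: row i O) ->
  char_poly A = \prod_i ('X - (mu i)%:P) ->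
  (forall i j : 'I_n, (i < j)%N -> mu j + C' < mu i) ->
  (forall i, `|mu i - z| < t) ->
  0 < C -> C *+ 2 <= C' -> C <= t ->
  `|c - z| <= t -> \sum_i beta i ^+ 2 < t ^+ 2 ->
  \sum_i beta i ^+ 2 <= t * (C' - C) ->
  (forall i, t * C *+ 4 < beta i ^+ 2) ->
  spread C z (t *+ 2) (block_mx c%:M b b^T A : 'M[R]_(1 + n)).
Proof.
move=> OO OA charA mugap muz C0 CC2 Ct cz St SC betai; have CC' : C < C' by lra.
pose r x := x - c - \sum_i beta i ^+ 2 / (x - mu i).
have /andP[c1 c2] : - t <= c - z <= t by rewrite -ler_norml.
have muz' i : - t < mu i - z /\ mu i - z < t.
  by apply/andP; rewrite -ltr_norml.
have ST : (\sum_i beta i ^+ 2) / t < t by rewrite ltr_pdivrMr; [rewrite -expr2|lra].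
(* At x = z + 2t all the mu_j are more than t away and x - c >= t, whereas the sum over the poles is
   below t; the point z - 2t is symmetric. *)
have r_hi : 0 < r (z + t *+ 2).
  have : `|\sum_i beta i ^+ 2 / (z + t *+ 2 - mu i)| <= (\sum_i beta i ^+ 2) / t.
    apply: norm_sum_sqr_div => [|j _]; first lra.
    by have := ler_norm (z + t *+ 2 - mu j); have [] := muz' j; lra.
  by rewrite ler_norml => /andP[_]; rewrite /r; lra.
have r_lo : r (z - t *+ 2) < 0.
  have : `|\sum_i beta i ^+ 2 / (z - t *+ 2 - mu i)| <= (\sum_i beta i ^+ 2) / t.
    apply: norm_sum_sqr_div => [|j _]; first lra.
    by rewrite -normrN; have := ler_norm (- (z - t *+ 2 - mu j)); have [] := muz' j; lra.
  by rewrite ler_norml => /andP[+ _]; rewrite /r; lra.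
have SC' : (\sum_i beta i ^+ 2) / (C' - C) <= t by rewrite ler_pdivrMr; lra.
(* At x = mu_k +- C one has |x - c| < 3t, since |mu_k - z|, |c - z| and C are each at most t, and
   the other poles contribute at most t. The pole at mu_k exceeds 4t and decides the sign. *)
have betaC k : t *+ 4 < beta k ^+ 2 / C by rewrite ltr_pdivlMr// mulrnAl.
have rest k (s : R) : `|s| <= C ->
    `|\sum_(j | j != k) beta j ^+ 2 / (mu k + s - mu j)| <= t.
  rewrite ler_norml => /andP[s1 s2].
  apply: le_trans SC'; apply: norm_sum_sqr_div; first lra.
  move=> j; rewrite neq_ltn => /orP[] jk; have := mugap _ _ jk => ?.
    by rewrite -normrN; have := ler_norm (- (mu k + s - mu j)); lra.
  by have := ler_norm (mu k + s - mu j); lra.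
have r_right k : r (mu k + C) < 0.
  rewrite /r (bigD1 k)//= [mu k + C - mu k]addrAC subrr add0r.
  have := @rest k C; rewrite gtr0_norm// lexx => /(_ isT); rewrite ler_norml => /andP[+ _].
  by have := betaC k; have [] := muz' k; lra.
have r_left k : 0 < r (mu k - C).
  rewrite /r (bigD1 k)//= [mu k - C - mu k]addrAC subrr add0r invrN mulrN.
  have := @rest k (- C); rewrite normrN gtr0_norm// lexx => /(_ isT).
  rewrite ler_norml => /andP[_].
  by have := betaC k; have [] := muz' k; lra.
(* [lift ord_max] keeps the value of an index and [lift ord0] raises it by one, so [a i] comes from
   mu_i and [d i] from mu_(i-1). *)
pose a (i : 'I_(1 + n)) := if unlift ord_max i is Some k then mu k + C else z - t *+ 2.
pose d (i : 'I_(1 + n)) := if unlift ord0 i is Some k then mu k - C else z + t *+ 2.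
have aP i : (exists2 k : 'I_n, val i = val k & a i = mu k + C) \/
    val i = n /\ a i = z - t *+ 2.
  rewrite /a; case: unliftP => [k ->|->]; last by right.
  by left; exists k; rewrite //= /bump leqNgt ltn_ord.
have dP i : (exists2 k : 'I_n, val i = (val k).+1 & d i = mu k - C) \/
    val i = 0%N /\ d i = z + t *+ 2.
  rewrite /d; case: unliftP => [k ->|->]; last by right.
  by left; exists k.
(* Both end points lie strictly between mu_i and mu_(i-1), where these exist, so [char_poly A] has
   the same sign at both and the sign change comes from [r] alone. *)
have a_hi (i : 'I_(1 + n)) (j : 'I_n) : (j < i)%N -> a i < mu j.
  case: (aP i) => [[k -> ->] /mugap|[_ ->] _]; first lra.
  by have [] := muz' j; lra.
have a_lo (i : 'I_(1 + n)) (j : 'I_n) : (i <= j)%N -> mu j < a i.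
  case: (aP i) => [[k -> ->]|[-> _]]; last by rewrite leqNgt ltn_ord.
  by rewrite leq_eqVlt => /orP[/eqP/val_inj->|/mugap]; lra.
have d_hi (i : 'I_(1 + n)) (j : 'I_n) : (j < i)%N -> d i < mu j.
  case: (dP i) => [[k -> ->]|[-> _]] //; rewrite ltnS.
  by rewrite leq_eqVlt => /orP[/eqP/val_inj->|/mugap]; lra.
have d_lo (i : 'I_(1 + n)) (j : 'I_n) : (i <= j)%N -> mu j < d i.
  case: (dP i) => [[k -> ->] /mugap|[_ ->] _]; first lra.
  by have [] := muz' j; lra.
have ra i : r (a i) < 0 by case: (aP i) => [[k _ ->]|[_ ->]].
have rd i : 0 < r (d i) by case: (dP i) => [[k _ ->]|[_ ->]].
apply: (@spread_from_sign _ _ _ _ _ _ a d); first exact: ltW.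
- move=> i; case: (aP i) => [[k ik ->]|[ik ->]]; case: (dP i) => [[l il ->]|[il ->]].
  + have : (l < k)%N by rewrite -ik il.
    by move=> /mugap; lra.
  + by have [] := muz' k; lra.
  + by have [] := muz' l; lra.
  + lra.
- by move=> i; case: (aP i) => [[k _ ->]|[_ ->]]; [have [] := muz' k; lra|].
- by move=> i; case: (dP i) => [[k _ ->]|[_ ->]]; [have [] := muz' k; lra|].
(* Here d_j + C = mu_(j-1), which is at most mu_i < a_i because i < j. *)
- move=> i j ij; case: (dP j) => [[l jl ->]|[j0]]; last by move: ij; rewrite j0.
  rewrite subrK ltW//; case: (aP i) => [[k ik ->]|[ik _]]; last first.
    by have := leq_trans ij (ltn_ord j : (j <= n)%N); rewrite ik ltnn.
  have : (k <= l)%N by rewrite -ik -ltnS -jl.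
  by rewrite leq_eqVlt => /orP[/eqP/val_inj->|/mugap]; lra.
- move=> i.
  have nmu x : (forall j : 'I_n, (j < i)%N -> x < mu j) ->
      (forall j : 'I_n, (i <= j)%N -> mu j < x) -> forall j, x != mu j.
    move=> hi lo j; have [/lo|/hi] := leqP i j; first by move/gt_eqF->.
    by move/lt_eqF->.
  rewrite !(horner_char_poly_bordered _ _ OO OA);
    [|exact: nmu (d_hi i) (d_lo i)|exact: nmu (a_hi i) (a_lo i)].
  rewrite mulrACA pmulr_llt0; first by rewrite pmulr_llt0 ?ra ?rd.
  rewrite charA !horner_prod -big_split; apply: prodr_gt0 => j _; rewrite !hornerE.
  have [ij|ji] := leqP i j; first by rewrite mulr_gt0// subr_gt0 ?a_lo ?d_lo.
  by rewrite nmulr_rgt0 subr_lt0 ?a_hi ?d_hi.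
Qed.

(** * Measurability of spectral events *)

Lemma measurable_horner_char_poly (R : realType) d (T : measurableType d) n
    (F : T -> 'M[R]_n) (x : R) :
  (forall i j, measurable_fun setT (fun w => F w i j)) ->
  measurable_fun setT (fun w => (char_poly (F w)).[x]).
Proof.
move=> mF; under eq_fun do rewrite horner_char_poly /determinant.
apply: measurable_sum => s; apply: measurable_funM => //.
apply: measurable_prod => i _ /=; under eq_fun do rewrite !mxE.
exact: measurable_funB.
Qed.

Lemma measurable_spread (R : realType) d (T : measurableType d) n
    (F : T -> 'M[R]_n) (C z t : R) : 0 <= C ->
  (forall i j, measurable_fun setT (fun w => F w i j)) ->
  measurable [set w | spread C z t (F w)].
Proof.
move=> C0 mF.
pose good (ab : {ffun 'I_n -> rat * rat}) :=
  [/\ forall i, ratr (ab i).1 < ratr (ab i).2 :> R,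
      forall i, z - t <= ratr (ab i).1,
      forall i, ratr (ab i).2 <= z + t &
      forall i j : 'I_n, (i < j)%N -> ratr (ab j).2 + C <= ratr (ab i).1].
pose S (ab : {ffun 'I_n -> rat * rat}) : set T :=
  if `[< good ab >] then \bigcap_(i in [set: 'I_n])
    [set w | (char_poly (F w)).[ratr (ab i).1] * (char_poly (F w)).[ratr (ab i).2] < 0]
  else set0.
rewrite (_ : [set w | _] = \bigcup_ab S ab).
  apply: countable_bigcupT_measurable => [|ab]; first exact: countableP.
  rewrite /S; case: asboolP => // _.
  apply: fin_bigcap_measurable => // i _.
  have := measurable_funM (measurable_horner_char_poly (ratr (ab i).1) mF)
    (measurable_horner_char_poly (ratr (ab i).2) mF).
  move=> /(_ measurableT `]-oo, 0[%classic); rewrite setTI.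
  have -> : [set w | (char_poly (F w)).[ratr (ab i).1] * (char_poly (F w)).[ratr (ab i).2] < 0] =
    (fun w => (char_poly (F w)).[ratr (ab i).1] * (char_poly (F w)).[ratr (ab i).2]) @^-1` `]-oo, 0[%classic.
    by apply/seteqP; split => w /=; rewrite in_itv.
  by apply; exact: measurable_itv.
apply/seteqP; split => w /=.
  move=> /(spread_to_rat_sign C0)[ab [h1 h2 h3 h4 h5]]; exists ab => //.
  by rewrite /S asboolT// => i _; exact: h5.
move=> [ab _]; rewrite /S; case: asboolP => // -[h1 h2 h3 h4] h5.
apply: (spread_from_sign C0 h1 h2 h3 h4) => i; exact: h5.
Qed.

Lemma measurable_mx_entry (R : realType) m n (i : 'I_m) (j : 'I_n) :
  measurable_fun setT (fun A : 'M[R]_(m, n) => A i j).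
Proof.
apply: (measurability _ (RGenOpens.measurableE R)) => _ [_ [a [b ->] <-]].
rewrite setTI; apply: sub_sigma_algebra.
by have /continuousP := @coord_continuous R m n i j; apply; exact: interval_open.
Qed.

(** Integer radii about 0 turn the event on the minimal gap into a countable union of [spread]
    events, which gives its measurability. *)
Lemma min_gap_gtP (R : realType) m (C : R) (A : 'M[R]_m) : 0 < C -> (1 < m)%N ->
  C < min_gap A <-> exists k : nat, spread C 0 k%:R A.
Proof.
move=> C0 m1.
have r_trans : transitive (fun x y : R => y + C < x) by move=> y x z; lra.
split=> [|[k [mu [charA mugap _]]]].
  move=> /bigmin_gtP[Cgap0 Cgap].
  (* The default empty sequence has all gaps zero, which C > 0 rules out. *)
  have [E|s0] := eqVneq (eigenvalues A) [::].
    by move: Cgap0; rewrite /gap E /= subrr; lra.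
  have charA : char_poly A = \prod_(a <- eigenvalues A) ('X - a%:P).
    move: s0; rewrite /eigenvalues; case: xgetP => [t tE []//|_].
    by rewrite eqxx.
  have ssize : size (eigenvalues A) = m.
    by have := congr1 (fun p : {poly R} => size p) charA; rewrite size_char_poly size_prod_XsubC => -[].
  have : sorted (fun x y => y + C < x) (eigenvalues A).
    apply/(sortedP 0) => i; rewrite ssize => im.
    have im' : (i < m.-1)%N by rewrite -ltnS prednK// ltnW.
    by have := Cgap (Ordinal im') isT; rewrite /gap /=; lra.
  set s := eigenvalues A in charA ssize * => s_sorted.
  pose N := \big[Num.max/0]_(i < m) `|s`_i|.
  exists (Num.trunc N).+1; exists (fun i => s`_i); split.
  - by rewrite charA (big_nth 0) ssize big_mkord.
  - move=> i j ij; apply: (sorted_ltn_nth r_trans 0 s_sorted) => //;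
      by rewrite inE ssize.
  - move=> i; rewrite subr0; apply: le_lt_trans (truncnS_gt N).
    exact: (@le_bigmax_cond _ _ _ 0 i xpredT (fun i : 'I_m => `|s`_i|)).
pose s := [seq mu i | i <- enum 'I_m].
have s_size : size s = m by rewrite size_map size_enum_ord.
have sE (i : 'I_m) : s`_i = mu i.
  by rewrite (nth_map i) ?size_enum_ord// nth_ord_enum.
have -> : min_gap A = \big[Num.min/(s`_0 - s`_1)]_(k < m.-1) (s`_k - s`_k.+1).
  have eA : eigenvalues A = s.
    apply: eigenvaluesE; last by rewrite charA big_map big_enum.
    apply/(sortedP 0) => i; rewrite s_size /= => im.
    rewrite (sE (Ordinal im)) (sE (Ordinal (ltnW im))).
    by have /= := mugap (Ordinal (ltnW im)) (Ordinal im) (ltnSn i) => /=; lra.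
  by rewrite /min_gap /gap eA.
have sgap i : (i.+1 < m)%N -> C < s`_i - s`_i.+1.
  move=> im; rewrite (sE (Ordinal im)) (sE (Ordinal (ltnW im))).
  have := mugap (Ordinal (ltnW im)) (Ordinal im) (ltnSn i) => /=; lra.
apply/bigmin_gtP; split=> [|i _]; first exact: sgap.
by apply: sgap; rewrite -ltn_predRL.
Qed.

Lemma measurable_min_gap_gt (R : realType) d (T : measurableType d) m
    (F : T -> 'M[R]_m) (C : R) : 0 < C -> (1 < m)%N ->
  (forall i j, measurable_fun setT (fun w => F w i j)) ->
  measurable [set w | C < min_gap (F w)].
Proof.
move=> C0 m1 mF.
rewrite (_ : [set _ | _] = \bigcup_k [set w | spread C 0 k%:R (F w)]).
  by apply: bigcupT_measurable => k; apply: measurable_spread => //; exact: ltW.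
apply/seteqP; split=> w /=; first by move=> /(min_gap_gtP _ C0 m1)[k]; exists k.
by move=> [k _ wk]; apply/(min_gap_gtP _ C0 m1); exists k.
Qed.

(** * Conditioning on a block of independent coordinates *)

(* The two sub-sigma-algebras live on [T] itself: independence says that the
   diagonal map pushes [P] forward to the product of its two restrictions. *)
Lemma decoupling (R : realType) d (T : measurableType d) (P : probability T R)
    (G1 G2 : set (set T))
    (f : g_sigma_algebraType G1 * g_sigma_algebraType G2 -> \bar R) :
  <<s G1 >> `<=` measurable -> <<s G2 >> `<=` measurable ->
  (forall A B, <<s G1 >> A -> <<s G2 >> B -> P (A `&` B) = (P A * P B)%E) ->
  measurable_fun setT f -> (forall x, (0 <= f x)%E) ->
  (\int[P]_w f (w, w) = \int[P]_w \int[P]_w' f (w, w'))%E.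
Proof.
move=> sG1 sG2 indep mf f0.
pose T1 := g_sigma_algebraType G1; pose T2 := g_sigma_algebraType G2.
have m1 : measurable_fun setT (fun w : T => w : T1).
  by move=> _ Y mY; rewrite setTI; exact: sG1.
have m2 : measurable_fun setT (fun w : T => w : T2).
  by move=> _ Y mY; rewrite setTI; exact: sG2.
have m12 : measurable_fun setT (fun w : T => (w, w) : T1 * T2).
  exact: measurable_fun_pair.
pose i1 := HB.pack_for {mfun T >-> T1} (fun w : T => w : T1)
  (isMeasurableFun.Build _ _ _ _ _ m1).
pose i2 := HB.pack_for {mfun T >-> T2} (fun w : T => w : T2)
  (isMeasurableFun.Build _ _ _ _ _ m2).
pose i12 := HB.pack_for {mfun T >-> (T1 * T2)%type}
  (fun w : T => (w, w) : T1 * T2) (isMeasurableFun.Build _ _ _ _ _ m12).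
transitivity (\int[distribution P i12]_z f z)%E.
  by rewrite ge0_integral_distribution.
transitivity (\int[(distribution P i1 \x distribution P i2)%E]_z f z)%E.
  apply: eq_measure_integral => A mA _; apply/esym/product_measure_unique => // B C mB mC; exact: indep.
rewrite (fubini_tonelli1 _ mf f0) ge0_integral_distribution//=; last 2 first.
- exact: measurable_fun_fubini_tonelli_F.
- by move=> w; apply: integral_ge0.
apply: eq_integral => w _ /=; rewrite /fubini_F ge0_integral_distribution//.
exact: measurable_fun_pair2.
Qed.

(** Independence and law in a single product formula. A general finite index type covers the entries
    of a matrix, indexed by pairs. *)
Definition iid_normal (R : realType) d (T : measurableType d) (P : probability T R)
    (I : finType) (X : I -> T -> R) : Prop :=
  (forall i, measurable_fun setT (X i)) /\
  forall B : I -> set R, (forall i, measurable (B i)) ->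
    P (\bigcap_(i in [set: I]) X i @^-1` B i) = (\prod_i normal_prob 0 1 (B i))%E.

(** Cylinder sets over the coordinates in [J]: a pi-system generating the sigma-algebra of these
    coordinates. *)
Definition block (R : realType) (T : Type) (I : finType) (X : I -> T -> R)
    (J : pred I) : set (set T) :=
  [set A | exists2 B : I -> set R, (forall i, measurable (B i)) &
           A = \bigcap_(i in [set i | J i]) X i @^-1` B i].

Section blocks.
Context (R : realType) d (T : measurableType d) (P : probability T R).
Context (I : finType) (X : I -> T -> R) (iidX : iid_normal P X).

Let mX i : measurable_fun setT (X i). Proof. by case: iidX. Qed.

Lemma sub_block_measurable (J : pred I) : <<s block X J >> `<=` measurable.
Proof.
apply: smallest_sub; first exact: sigma_algebra_measurable.
move=> _ [B mB ->]; apply: fin_bigcap_measurable => // i _.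
by rewrite -[X in measurable X]setTI; exact: mX.
Qed.

Lemma block_setI (J : pred I) : setI_closed (block X J).
Proof.
move=> _ _ [B mB ->] [C mC ->]; exists (fun i => B i `&` C i).
  by move=> i; exact: measurableI.
by rewrite -bigcapI; apply: eq_bigcapr => i _; rewrite preimage_setI.
Qed.

Lemma block_setT (J : pred I) : block X J setT.
Proof.
by exists (fun=> setT) => //; apply/seteqP; split.
Qed.

Lemma measure_block (J : pred I) (B : I -> set R) : (forall i, measurable (B i)) ->
  P (\bigcap_(i in [set i | J i]) X i @^-1` B i) =
  (\prod_i normal_prob 0 1 (if J i then B i else setT))%E.
Proof.
move=> mB; have [_ <-] := iidX; last by move=> i; case: ifP.
congr (P _); apply/seteqP; split => w /= h i.
  by move=> _; case: ifPn => // /h.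
by move=> Ji; have := h i Logic.I; rewrite Ji.
Qed.

Lemma block_independent (J : pred I) A B :
  <<s block X J >> A -> <<s block X (predC J) >> B -> P (A `&` B) = (P A * P B)%E.
Proof.
have Punique (G : set (set T)) (C : set T) : G `<=` measurable -> setI_closed G ->
    G setT -> measurable C -> (forall A, G A -> P (A `&` C) = (P C * P A)%E) ->
    forall A, <<s G >> A -> P (A `&` C) = (P C * P A)%E.
  move=> Gm GI GT mC GE D sD.
  have cover : \bigcup_(k in [set: nat]) [set: T] = setT.
    by apply/seteqP; split => // x _; exists 0%N.
  have PC0 : 0 <= fine (P C) by rewrite fine_ge0.
  have PCE : (fine (P C))%:E = P C by rewrite fineK// fin_num_measure.
  have mE : forall D, <<s G >> D -> mrestr P mC D = mscale (NngNum PC0) P D.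
    apply: (@g_sigma_algebra_measure_unique _ R T G Gm (fun=> setT)) => // [D' GD|k].
      by rewrite [LHS]GE// -{1}PCE.
    by apply: (@le_lt_trans _ _ 1%E); rewrite ?ltry// [leLHS]/= /mrestr setTI probability_le1.
  by have := mE _ sD; rewrite /mrestr /mscale /= PCE.
have Gm (K : pred I) : block X K `<=` measurable.
  by move=> D GD; apply: (@sub_block_measurable K); exact: sub_sigma_algebra.
move=> sA sB; rewrite muleC.
apply: (Punique (block X J)) sA => //; [exact: block_setI|exact: block_setT| |].
  exact: sub_block_measurable sB.
move=> {A}_ [A mA ->]; rewrite setIC muleC.
apply: (Punique (block X (predC J))) sB => //; [exact: block_setI|exact: block_setT| |].
  by apply: (@sub_block_measurable J); apply: sub_sigma_algebra; exists A.
move=> {B}_ [B mB ->].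
rewrite !measure_block// -big_split /=.
(* Two cylinders over complementary index sets form one box over all of [I], to which the product
   formula applies. *)
rewrite (_ : _ `&` _ = \bigcap_(i in [set: I]) X i @^-1` (if J i then A i else B i)).
  have [_ ->] := iidX; last by move=> i; case: ifP.
  apply: eq_bigr => i _; case: (J i) => /=.
    by rewrite probability_setT mule1.
  by rewrite probability_setT mul1e.
apply/seteqP; split => w /=.
  by move=> [hB hA] i _; case: ifPn => [/hA//|Ji]; exact: hB.
by move=> h; split => i /=; [move=> /negbTE Ji|move=> Ji]; have := h i Logic.I; rewrite Ji.
Qed.

Lemma measurable_block (J : pred I) i : J i ->
  measurable_fun [set: g_sigma_algebraType (block X J)] (X i).
Proof.
move=> Ji _ Y mY; rewrite setTI; apply: sub_sigma_algebra.
exists (fun j => if j == i then Y else setT); first by move=> j; case: ifP.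
apply/seteqP; split => w /=; last by move=> /(_ i Ji) /=; rewrite eqxx.
by move=> Xw j _ /=; case: eqP => [->|].
Qed.

Lemma measurable_block_fst (J K : pred I) i : J i ->
  measurable_fun setT (fun w : g_sigma_algebraType (block X J) *
    g_sigma_algebraType (block X K) => X i w.1).
Proof.
move=> Ji; have := measurableT_comp (measurable_block Ji)
  (@measurable_fst _ _ (g_sigma_algebraType (block X J)) (g_sigma_algebraType (block X K))).
exact.
Qed.

Lemma measurable_block_snd (J K : pred I) i : K i ->
  measurable_fun setT (fun w : g_sigma_algebraType (block X J) *
    g_sigma_algebraType (block X K) => X i w.2).
Proof.
move=> Ki; have := measurableT_comp (measurable_block Ki)
  (@measurable_snd _ _ (g_sigma_algebraType (block X J)) (g_sigma_algebraType (block X K))).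
exact.
Qed.

(** Freezes the coordinates in [J] and integrates first over the others; the inductions below peel
    off one Gaussian coordinate or column this way. *)
Lemma integral_block (J : pred I)
    (f : g_sigma_algebraType (block X J) * g_sigma_algebraType (block X (predC J)) -> \bar R) :
  measurable_fun setT f -> (forall x, (0 <= f x)%E) ->
  (\int[P]_w f (w, w) = \int[P]_w \int[P]_w' f (w, w'))%E.
Proof.
move=> mf f0; apply: decoupling => //; [exact: sub_block_measurable..|].
exact: block_independent.
Qed.

End blocks.

(** * Gaussian integrals and tail bounds *)

(** The Radon-Nikodym derivative and [normal_pdf] have the same integral over every measurable set,
    so they agree almost everywhere. *)
Lemma ge0_integral_normal_prob (R : realType) (m s : R) (f : R -> \bar R) :
  measurable_fun setT f -> (forall x, (0 <= f x)%E) ->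
  (\int[normal_prob m s]_x f x =
   \int[lebesgue_measure]_x (f x * (normal_pdf m s x)%:E))%E.
Proof.
move=> mf f0.
have dom := @normal_prob_dominates R m s.
rewrite -(Radon_Nikodym_SigmaFinite.change_of_variables dom)//.
have mg : measurable_fun setT (Radon_Nikodym_SigmaFinite.f (normal_prob m s) (@lebesgue_measure R)).
  exact: measurable_int (Radon_Nikodym_SigmaFinite.f_integrable dom).
have mpdf : measurable_fun setT (fun x => (normal_pdf m s x)%:E).
  by apply/measurable_EFinP; exact: measurable_normal_pdf.
apply: ae_eq_integral => //; [exact: emeasurable_funM..|].
apply: ae_eqe_mul2l; apply: integral_ae_eq => //.
  exact: Radon_Nikodym_SigmaFinite.f_integrable.
by move=> A _ mA; rewrite -Radon_Nikodym_SigmaFinite.f_integral.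
Qed.

Lemma measurable_expR_quadratic (R : realType) d (T : measurableType d) (k : R)
    (g : T -> R) : measurable_fun setT g ->
  measurable_fun setT (fun w => (expR (- (k * g w ^+ 2 / 2)))%:E).
Proof.
move=> mg; apply/measurable_EFinP; apply: measurableT_comp => //.
apply: measurable_funN; apply: measurable_funM => //.
by apply: measurable_funM => //; exact: measurable_funX.
Qed.

(** Completing the square: with u = 1 + k a^2, the integrand times the standard density is a
    constant multiple of the normal density of mean - k a x / u and variance 1 / u. Negative k is
    allowed as long as u > 0. *)
Lemma integral_expR_quadratic (R : realType) (k a x : R) :
  0 < 1 + k * a ^+ 2 ->
  (\int[normal_prob 0 1]_z (expR (- (k * (x + a * z) ^+ 2 / 2)))%:E =
   ((Num.sqrt (1 + k * a ^+ 2))^-1 *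
     expR (- (k / (1 + k * a ^+ 2) * x ^+ 2 / 2)))%:E)%E.
Proof.
move=> u0; set u := 1 + k * a ^+ 2 in u0 *.
have su0 : 0 < Num.sqrt u by rewrite sqrtr_gt0.
have su2 : Num.sqrt u ^+ 2 = u by rewrite sqr_sqrtr// ltW.
rewrite ge0_integral_normal_prob; last 2 first.
- by apply: measurable_expR_quadratic; apply: measurable_funD => //; exact: measurable_funM.
- by move=> z; rewrite lee_fin expR_ge0.
under eq_integral => z _.
  rewrite -EFinM (_ : _ * _ = (Num.sqrt u)^-1 * expR (- (k / u * x ^+ 2 / 2)) *
      normal_pdf (- (k * a * x / u)) (Num.sqrt u)^-1 z); last first.
    rewrite !normal_pdfE ?oner_eq0 ?invr_eq0 ?gt_eqF// /normal_peak /normal_fun.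
    rewrite exprVn su2 expr1n mul1r subr0.
    have -> : (Num.sqrt (u^-1 * pi *+ 2))^-1 = Num.sqrt u * (Num.sqrt (pi *+ 2))^-1.
      by rewrite -mulrnAr sqrtrM ?invr_ge0 ?ltW// sqrtrV ?ltW// invfM invrK.
    rewrite mulrCA -expRD [RHS]mulrACA -expRD mulKf ?gt_eqF//.
    congr (_ * expR _); rewrite /u; field.
    by rewrite gt_eqF.
  rewrite EFinM; over.
rewrite ge0_integralZl//.
- by rewrite integral_normal_pdf mule1.
- by apply/measurable_EFinP; exact: measurable_normal_pdf.
- by move=> z _; rewrite lee_fin normal_pdf_ge0.
Qed.

Section iid_normal_theory.
Context (R : realType) d (T : measurableType d) (P : probability T R).

Lemma iid_normal_law (I : finType) (X : I -> T -> R) i (B : set R) :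
  iid_normal P X -> measurable B -> P (X i @^-1` B) = normal_prob 0 1 B.
Proof.
move=> [mX iX] mB.
have := iX (fun j => if j == i then B else setT).
rewrite (bigD1 i)//= eqxx big1 ?mule1; last first.
  by move=> j /negbTE ->; exact: probability_setT.
move=> <-; last by move=> j; case: ifP.
congr (P _); apply/seteqP; split => w /=; last by move=> /(_ i Logic.I) /=; rewrite eqxx.
by move=> Xw j _ /=; case: eqP => [->|].
Qed.

Lemma ge0_integral_iid_normal (I : finType) (X : I -> T -> R) i (f : R -> \bar R) :
  iid_normal P X -> measurable_fun setT f -> (forall x, (0 <= f x)%E) ->
  (\int[P]_w f (X i w) = \int[normal_prob 0 1]_x f x)%E.
Proof.
move=> iX mf f0; have [mX _] := iX.
have mXi : measurable_fun setT (X i : T -> measurableTypeR R) by exact: mX.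
pose Xi := HB.pack_for {mfun T >-> measurableTypeR R} (X i : T -> measurableTypeR R)
  (isMeasurableFun.Build _ _ _ _ _ mXi).
rewrite -[LHS](ge0_integral_distribution (P := P) Xi mf f0).
by apply: (eq_measure_integral (normal_prob 0 1)) => A mA _; exact: iid_normal_law.
Qed.

Lemma iid_normal_inj (I K : finType) (X : I -> T -> R) (e : K -> I) :
  injective e -> iid_normal P X -> iid_normal P (fun k => X (e k)).
Proof.
move=> e_inj [mX iX]; split=> [k|B mB]; first exact: mX.
(* Off the image of [e] the whole line is taken, of mass 1, so these factors drop out. *)
pose B' i := if [pick k | e k == i] is Some k then B k else setT.
have B'e k : B' (e k) = B k.
  by rewrite /B'; case: pickP => [l /eqP/e_inj-> //|/(_ k)/=]; rewrite eqxx.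
have B'o i : i \notin codom e -> B' i = setT.
  by rewrite /B'; case: pickP => // k /eqP <-; rewrite codom_f.
have := iX B'; rewrite (bigID (mem (codom e)))/= [X in (_ * X)%E]big1 ?mule1; last first.
  by move=> i /B'o ->; exact: probability_setT.
rewrite -big_uniq/=; last by rewrite map_inj_uniq// enum_uniq.
rewrite big_map big_enum/= (eq_bigr (fun k => normal_prob 0 1 (B k))); last first.
  by move=> k _; rewrite B'e.
move=> <-; last by move=> i; rewrite /B'; case: pickP.
congr (P _); apply/seteqP; split => w /= h i _ /=; last by rewrite -B'e; exact: h.
have [/codomP[k ->]|/B'o->//] := boolP (i \in codom e).
by rewrite B'e; exact: h.
Qed.

(** Integrating out coordinate 0 reproduces the same form with k replaced by k / (1 + k a_0^2),
    which is why k varies in the induction. *)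
Lemma integral_expR_linear n (X : 'I_n -> T -> R) (a : 'I_n -> R) (k x : R) :
  iid_normal P X -> 0 < 1 + k * \sum_i a i ^+ 2 ->
  (\int[P]_w (expR (- (k * (x + \sum_i a i * X i w) ^+ 2 / 2)))%:E =
   ((Num.sqrt (1 + k * \sum_i a i ^+ 2))^-1 *
     expR (- (k / (1 + k * \sum_i a i ^+ 2) * x ^+ 2 / 2)))%:E)%E.
Proof.
elim: n X a k x => [|n IH] X a k x iX.
  rewrite big_ord0 mulr0 addr0 => _; under eq_integral do rewrite big_ord0 addr0.
  by rewrite integral_cst//= probability_setT mule1 sqrtr1 invr1 mul1r mulr1.
rewrite big_ord_recl; set S := \sum_(i < n) _ => kS.
have S0 : 0 <= S by apply: sumr_ge0 => i _; exact: sqr_ge0.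
have u0 : 0 < 1 + k * a ord0 ^+ 2.
  have [k0|k0] := leP 0 k; first by rewrite ltr_pwDl// mulr_ge0// sqr_ge0.
  (* For k < 0 the factor of one coordinate is at least the full one, positive by assumption. *)
  by apply: (lt_le_trans kS); rewrite lerD2l mulrDr gerDl mulr_le0_ge0// ltW.
pose J : pred 'I_n.+1 := predC1 ord0.
pose L (w : T) := x + \sum_(i < n) a (lift ord0 i) * X (lift ord0 i) w.
pose f (w : g_sigma_algebraType (block X J) * g_sigma_algebraType (block X (predC J))) :=
  (expR (- (k * (L w.1 + a ord0 * X ord0 w.2) ^+ 2 / 2)))%:E.
transitivity (\int[P]_w f (w, w))%E.
  by apply: eq_integral => w _; rewrite /f /L /= big_ord_recl -addrA (addrC (\sum_(i < n) _)).
rewrite (integral_block iX); last 2 first.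
- apply: measurable_expR_quadratic; apply: measurable_funD.
    apply: measurable_funD => //; apply: measurable_sum => i.
    apply: measurable_funM => //.
    exact: measurable_block_fst.
  apply: measurable_funM => //.
  exact: measurable_block_snd.
- by move=> w; rewrite lee_fin expR_ge0.
under eq_integral => w _.
  rewrite /f /= (ge0_integral_iid_normal ord0
    (f := fun z => (expR (- (k * (L w + a ord0 * z) ^+ 2 / 2)))%:E) iX).
  - rewrite integral_expR_quadratic// EFinM.
    over.
  - by apply: measurable_expR_quadratic; apply: measurable_funD => //; exact: measurable_funM.
  - by move=> z; rewrite lee_fin expR_ge0.
have [mX _] := iX.
rewrite ge0_integralZl; last 4 first.
- exact: measurableT.
- apply: measurable_expR_quadratic; apply: measurable_funD => //.
  by apply: measurable_sum => i; exact: measurable_funM.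
- by move=> w _; rewrite lee_fin expR_ge0.
- by rewrite lee_fin invr_ge0 sqrtr_ge0.
(* The normalising factors telescope: the factor of coordinate 0 cancels in the product of the two
   square roots. *)
have uS : 1 + k / (1 + k * a ord0 ^+ 2) * S =
    (1 + k * (a ord0 ^+ 2 + S)) / (1 + k * a ord0 ^+ 2).
  by field; rewrite gt_eqF.
rewrite (IH (fun i => X (lift ord0 i)) (fun i => a (lift ord0 i))); last 2 first.
- exact: iid_normal_inj lift_inj iX.
- by rewrite -/S uS divr_gt0.
rewrite -/S uS -EFinM mulrA -invfM -sqrtrM ?ltW// mulrCA divff ?gt_eqF// mulr1.
have kE (u v : R) : u != 0 -> k / u / (v / u) = k / v.
  by move=> u'0; rewrite invf_div mulrA divfK.
by rewrite kE // gt_eqF.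
Qed.

Lemma integral_expR_sum_sqr n (X : 'I_n -> T -> R) (k : R) :
  iid_normal P X -> 0 < 1 + k ->
  (\int[P]_w (expR (- (k * (\sum_i X i w ^+ 2) / 2)))%:E =
   ((Num.sqrt (1 + k))^-1 ^+ n)%:E)%E.
Proof.
move=> + k1; elim: n X => [|n IH] X iX.
  under eq_integral do rewrite big_ord0 mulr0 mul0r oppr0 expR0.
  by rewrite integral_cst//= probability_setT mule1 expr0.
have [mX _] := iX.
pose J : pred 'I_n.+1 := predC1 ord0.
pose L (w : T) := \sum_(i < n) X (lift ord0 i) w ^+ 2.
(* The trivial 0 + 1 * brings the factor of coordinate 0 to the form of [integral_expR_quadratic]
   with x = 0 and a = 1. *)
pose f (w : g_sigma_algebraType (block X J) * g_sigma_algebraType (block X (predC J))) :=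
  ((expR (- (k * L w.1 / 2)))%:E * (expR (- (k * (0 + 1 * X ord0 w.2) ^+ 2 / 2)))%:E)%E.
transitivity (\int[P]_w f (w, w))%E.
  apply: eq_integral => w _; rewrite /f /L /= big_ord_recl -EFinM -expRD.
  by congr (expR _)%:E; rewrite add0r mul1r; ring.
have mE d' (T' : measurableType d') (g : T' -> R) : measurable_fun setT g ->
    measurable_fun setT (fun w => (expR (- (k * g w / 2)))%:E).
  move=> mg; apply/measurable_EFinP; apply: measurableT_comp => //.
  by apply: measurable_funN; apply: measurable_funM => //; exact: measurable_funM.
rewrite (integral_block iX); last 2 first.
- apply: emeasurable_funM.
    apply: mE; apply: measurable_sum => i; apply: measurable_funX.
    exact: measurable_block_fst.
  apply: measurable_expR_quadratic; apply: measurable_funD => //.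
  apply: measurable_funM => //.
  exact: measurable_block_snd.
- by move=> w; rewrite mule_ge0 ?lee_fin ?expR_ge0.
under eq_integral => w _.
  rewrite /f /= (ge0_integral_iid_normal ord0 (f := fun z => ((expR (- (k * L w / 2)))%:E *
     (expR (- (k * (0 + 1 * z) ^+ 2 / 2)))%:E)%E) iX).
  - rewrite ge0_integralZl; last 4 first.
    + exact: measurableT.
    + by apply: measurable_expR_quadratic; apply: measurable_funD => //; exact: measurable_funM.
    + by move=> z _; rewrite lee_fin expR_ge0.
    + by rewrite lee_fin expR_ge0.
    rewrite integral_expR_quadratic expr1n mulr1// expr0n /= mulr0 mul0r oppr0 expR0 mulr1 muleC.
    over.
  - apply: emeasurable_funM => //.
    by apply: measurable_expR_quadratic; apply: measurable_funD => //; exact: measurable_funM.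
  - by move=> z; rewrite mule_ge0 ?lee_fin ?expR_ge0.
rewrite ge0_integralZl; last 4 first.
- exact: measurableT.
- by apply: mE; apply: measurable_sum => i; exact: measurable_funX.
- by move=> w _; rewrite lee_fin expR_ge0.
- by rewrite lee_fin invr_ge0 sqrtr_ge0.
rewrite (IH (fun i => X (lift ord0 i))); last exact: iid_normal_inj lift_inj iX.
by rewrite exprS EFinM.
Qed.

End iid_normal_theory.

Section tail_bounds.
Context (R : realType) d (T : measurableType d) (P : probability T R).

(** Markov's inequality, with [g] a majorant of the indicator. *)
Lemma probability_le_integral (A : set T) (g : T -> R) :
  measurable A -> measurable_fun setT (fun w => (g w)%:E) -> (forall w, 0 <= g w) ->
  (forall w, A w -> 1 <= g w) -> (P A <= \int[P]_w (g w)%:E)%E.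
Proof.
move=> mA mg g0 Ag; have -> : P A = (\int[P]_w (\1_A w)%:E)%E by rewrite integral_indic// setIT.
apply: ge0_le_integral => //.
- by apply/measurable_EFinP; exact: measurable_indic.
- move=> w _; rewrite lee_fin indicE; have [/set_mem/Ag//|_] := boolP (w \in A); exact: g0.
Qed.

Context n (X : 'I_n -> T -> R) (iX : iid_normal P X).

Let mX i : measurable_fun setT (X i). Proof. by case: iX. Qed.

Let mlin (a : 'I_n -> R) : measurable_fun setT (fun w => \sum_i a i * X i w).
Proof. by apply: measurable_sum => i; exact: measurable_funM. Qed.

Let mquad (a : 'I_n -> R) k : measurable_fun setT
  (fun w => (expR (- (k * (0 + \sum_i a i * X i w) ^+ 2 / 2)))%:E).
Proof. by apply: measurable_expR_quadratic; exact: measurable_funD. Qed.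

Let msqr : measurable_fun setT (fun w => \sum_i X i w ^+ 2).
Proof. by apply: measurable_sum => i; exact: measurable_funX. Qed.

Lemma measurable_lin_sqr_le (a : 'I_n -> R) s :
  measurable [set w | (\sum_i a i * X i w) ^+ 2 <= s].
Proof.
rewrite -[X in measurable X]setTI; have := measurable_funX 2 (mlin a).
by move=> /(_ measurableT `]-oo, s]%classic (measurable_itv _)); rewrite preimage_itvNyc.
Qed.

Lemma measurable_lin_sqr_ge (a : 'I_n -> R) s :
  measurable [set w | s <= (\sum_i a i * X i w) ^+ 2].
Proof.
rewrite -[X in measurable X]setTI; have := measurable_funX 2 (mlin a).
by move=> /(_ measurableT `[s, +oo[%classic (measurable_itv _)); rewrite preimage_itvcy.
Qed.

(** Markov's inequality with k = 1 / s: on the event exp (1/2 - L^2 / (2 s)) >= 1, where L is the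
    linear form, and the mean e^(1/2) / sqrt (1 + sum a_i^2 / s) is at most e^(1/2) sqrt (s / A). *)
Lemma lin_sqr_small_ball (a : 'I_n -> R) (s A : R) : 0 < s -> 0 < A ->
  A <= \sum_i a i ^+ 2 ->
  (P [set w | ((\sum_i a i * X i w) ^+ 2 <= s)%R] <=
   (expR (2^-1) * Num.sqrt (s / A))%:E)%E.
Proof.
move=> s0 A0 Aa.
pose g w := expR (2^-1) * expR (- (s^-1 * (0 + \sum_i a i * X i w) ^+ 2 / 2)).
have mg := mquad a s^-1.
have u0 : 0 < 1 + s^-1 * \sum_i a i ^+ 2.
  by rewrite ltr_pwDl// mulr_ge0 ?invr_ge0 ?ltW// (lt_le_trans A0).
apply: (@le_trans _ _ (\int[P]_w (g w)%:E)%E).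
  apply: probability_le_integral.
  - exact: measurable_lin_sqr_le.
  - by rewrite /g; under eq_fun do rewrite EFinM; exact: emeasurable_funM.
  - by move=> w; rewrite mulr_ge0 ?expR_ge0.
  - move=> w /= ws; rewrite /g -expRD -[leLHS]expR0 ler_expR add0r subr_ge0.
    by rewrite ler_pdivrMr// mulVf// mulrC ler_pdivrMr// mul1r.
rewrite /g; under eq_integral do rewrite EFinM.
rewrite ge0_integralZl; last 4 first.
- exact: measurableT.
- exact: mg.
- by move=> w _; rewrite lee_fin expR_ge0.
- by rewrite lee_fin expR_ge0.
rewrite integral_expR_linear// expr0n /= mulr0 mul0r oppr0 expR0 mulr1.
rewrite -EFinM lee_fin ler_pM2l ?expR_gt0// -sqrtrV; last exact: ltW.
apply: ler_wsqrtr; rewrite invf_ple ?posrE ?divr_gt0// invf_div mulrC.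
by rewrite ler_wpDl// ler_pM2l ?invr_gt0.
Qed.

Lemma lin_sqr_tail (a : 'I_n -> R) (M A : R) : 0 < A ->
  \sum_i a i ^+ 2 <= A *+ 2 ->
  (P [set w | (M * A <= (\sum_i a i * X i w) ^+ 2)%R] <= (2 * expR (- (M / 8)))%:E)%E.
Proof.
move=> A0 aA.
(* A negative [k] turns the Gaussian integral into an exponential moment. *)
pose k := - (4 * A)^-1.
pose g w := expR (- (M / 8)) * expR (- (k * (0 + \sum_i a i * X i w) ^+ 2 / 2)).
have mg := mquad a k.
(* The constant 4 in [k] keeps this factor at least 1/2, so that its inverse square root is at most
   the prefactor 2. *)
have u0 : 2^-1 <= 1 + k * \sum_i a i ^+ 2.
  have : (4 * A)^-1 * \sum_i a i ^+ 2 <= 2^-1.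
    by rewrite mulrC ler_pdivrMr ?mulr_gt0//; apply: (le_trans aA); lra.
  by rewrite /k; lra.
apply: (@le_trans _ _ (\int[P]_w (g w)%:E)%E).
  apply: probability_le_integral.
  - exact: measurable_lin_sqr_ge.
  - by rewrite /g; under eq_fun do rewrite EFinM; exact: emeasurable_funM.
  - by move=> w; rewrite mulr_ge0 ?expR_ge0.
  - move=> w /= ws; rewrite /g -expRD -[leLHS]expR0 ler_expR add0r /k.
    have : M <= (\sum_i a i * X i w) ^+ 2 / A by rewrite ler_pdivlMr.
    set Q := (\sum_i a i * X i w) ^+ 2.
    have -> : - (- (4 * A)^-1 * Q / 2) = Q / A / 8 by field; rewrite gt_eqF.
    lra.
rewrite /g; under eq_integral do rewrite EFinM.
rewrite ge0_integralZl; last 4 first.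
- exact: measurableT.
- exact: mg.
- by move=> w _; rewrite lee_fin expR_ge0.
- by rewrite lee_fin expR_ge0.
rewrite integral_expR_linear//; last by lra.
rewrite expr0n /= mulr0 mul0r oppr0 expR0 mulr1.
rewrite -EFinM lee_fin mulrC ler_pM2r ?expR_gt0// invf_ple ?posrE ?sqrtr_gt0; [|lra..].
rewrite -(@ler_pXn2r _ 2) ?nnegrE ?sqrtr_ge0// sqr_sqrtr; lra.
Qed.

(** A Chernoff bound for both tails: k > 0 controls small values of the sum, k < 0 large ones. *)
Lemma sum_sqr_chernoff (k c : R) : 0 < 1 + k ->
  (P [set w | (k * \sum_i X i w ^+ 2 <= c * n%:R)%R] <=
   ((expR (c / 2) / Num.sqrt (1 + k)) ^+ n)%:E)%E.
Proof.
move=> k1.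
pose g w := expR (c / 2) ^+ n * expR (- (k * (\sum_i X i w ^+ 2) / 2)).
have mg : measurable_fun setT (fun w => (expR (- (k * (\sum_i X i w ^+ 2) / 2)))%:E).
  apply/measurable_EFinP; apply: measurableT_comp => //.
  by apply: measurable_funN; apply: measurable_funM => //; exact: measurable_funM.
apply: (@le_trans _ _ (\int[P]_w (g w)%:E)%E).
  apply: probability_le_integral.
  - rewrite -[X in measurable X]setTI.
    have : measurable_fun setT (fun w => k * \sum_i X i w ^+ 2) by exact: measurable_funM.
    by move=> /(_ measurableT `]-oo, c * n%:R]%classic (measurable_itv _)); rewrite preimage_itvNyc.
  - by rewrite /g; under eq_fun do rewrite EFinM; exact: emeasurable_funM.
  - by move=> w; rewrite mulr_ge0 ?expR_ge0// exprn_ge0 ?expR_ge0.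
  - move=> w /= ws; rewrite /g -expRM_natl -expRD -[leLHS]expR0 ler_expR -mulr_natl; lra.
rewrite /g; under eq_integral do rewrite EFinM.
rewrite ge0_integralZl; last 4 first.
- exact: measurableT.
- exact: mg.
- by move=> w _; rewrite lee_fin expR_ge0.
- by rewrite lee_fin exprn_ge0// expR_ge0.
by rewrite integral_expR_sum_sqr// -EFinM -exprMn.
Qed.

End tail_bounds.

(** * Bordering a Gram matrix by a Gaussian column *)

(** From exp (- y) >= 1 - y one gets exp y <= 1 / (1 - y), and the first hypothesis says (1 + k) (1
    - y) > 1. *)
Lemma expR_lt_one_add (R : realType) (k y : R) :
  0 < k - y - k * y -> 0 < 1 - y -> expR y < 1 + k.
Proof.
move=> ky y1; have := expR_ge1Dx (- y); rewrite expRN => ey.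
have y0 := expR_gt0 y; have : (1 - y) * expR y <= 1.
  by rewrite -ler_pdivlMr// mul1r.
by move=> ?; rewrite -(ltr_pM2l y1); apply: (@le_lt_trans _ _ 1); lra.
Qed.

Lemma exprn_eventually_le (R : realType) (r e : R) : 0 <= r -> r < 1 -> 0 < e ->
  exists D, forall n, (D <= n)%N -> r ^+ n <= e.
Proof.
move=> r0 r1 e0; have : `|r| < 1 by rewrite ger0_norm.
move=> /cvg_expr /cvgrPdist_le /(_ e e0)[D _ Dn]; exists D => n /Dn.
by rewrite sub0r normrN ger0_norm// exprn_ge0.
Qed.

(** Each tail decays geometrically in n. [D] is chosen before the probability space, since the
    spaces change with n. *)
Lemma sum_sqr_concentration (R : realType) (eta e : R) :
  0 < eta -> eta < 1 -> 0 < e ->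
  exists D, forall n, (D <= n)%N ->
    forall d (T : measurableType d) (P : probability T R) (X : 'I_n -> T -> R),
      iid_normal P X ->
      (P [set w | (eta * n%:R <= `|\sum_i X i w ^+ 2 - n%:R|)%R] <= e%:E)%E.
Proof.
move=> eta0 eta1 e0.
have chernoff_lt1 (k c : R) : 0 < 1 + k -> expR c < 1 + k ->
    0 <= expR (c / 2) / Num.sqrt (1 + k) < 1.
  move=> k1 ck; rewrite divr_ge0 ?expR_ge0 ?sqrtr_ge0//=.
  rewrite ltr_pdivrMr ?sqrtr_gt0// mul1r.
  rewrite -(@ltr_pXn2r _ 2) ?nnegrE ?expR_ge0 ?sqrtr_ge0// sqr_sqrtr ?ltW//.
  by rewrite -expRM_natl mulrC divfK.
(* The lower tail uses k = eta and c = eta (1 - eta), the upper one k = - eta / 2, which keeps 1 + k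
   > 0, and c = k (1 + eta). Both satisfy exp c < 1 + k, so the Chernoff ratios are below 1. *)
pose k2 := - (eta / 2); pose c1 := eta * (1 - eta); pose c2 := k2 * (1 + eta).
have sq : 0 < eta ^+ 2 by rewrite exprn_gt0.
have sq1 : eta ^+ 2 < eta by rewrite expr2 gtr_pMl.
have cu : eta ^+ 3 < eta ^+ 2 by rewrite exprS gtr_pMl.
have /andP[r10 r11] : 0 <= expR (c1 / 2) / Num.sqrt (1 + eta) < 1.
  apply: chernoff_lt1; first lra.
  apply: expR_lt_one_add; rewrite /c1; last by rewrite mulrBr mulr1 -expr2; lra.
  have -> : eta - eta * (1 - eta) - eta * (eta * (1 - eta)) = eta ^+ 3 by ring.
  by rewrite exprn_gt0.
have /andP[r20 r21] : 0 <= expR (c2 / 2) / Num.sqrt (1 + k2) < 1.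
  apply: chernoff_lt1; first by rewrite /k2; lra.
  apply: expR_lt_one_add; rewrite /c2 /k2.
    have -> : - (eta / 2) - - (eta / 2) * (1 + eta) - - (eta / 2) * (- (eta / 2) * (1 + eta)) =
      (eta ^+ 2 - eta ^+ 3) / 4 by field.
    by rewrite divr_gt0// subr_gt0.
  have -> : 1 - - (eta / 2) * (1 + eta) = 1 + eta / 2 + eta ^+ 2 / 2 by field.
  lra.
have e2 : 0 < e / 2 by rewrite divr_gt0.
have [D1 D1P] := exprn_eventually_le r10 r11 e2.
have [D2 D2P] := exprn_eventually_le r20 r21 e2.
exists (maxn D1 D2) => n; rewrite geq_max => /andP[/D1P n1 /D2P n2] d T P X iX.
have [mX _] := iX.
have mS : measurable_fun setT (fun w => \sum_i X i w ^+ 2).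
  by apply: measurable_sum => i; exact: measurable_funX.
have mle (k c : R) : measurable [set w | k * \sum_i X i w ^+ 2 <= c].
  rewrite -[X in measurable X]setTI.
  have : measurable_fun setT (fun w => k * \sum_i X i w ^+ 2) by exact: measurable_funM.
  by move=> /(_ measurableT `]-oo, c]%classic (measurable_itv _)); rewrite preimage_itvNyc.
rewrite (_ : [set w | _] = [set w | eta * \sum_i X i w ^+ 2 <= c1 * n%:R] `|`
    [set w | k2 * \sum_i X i w ^+ 2 <= c2 * n%:R]).
  apply: (le_trans (measureU2 _ _ _)); [exact: mle..|].
  rewrite (splitr e) EFinD leeD//.
    by apply: (le_trans (sum_sqr_chernoff iX _ _)); [lra|rewrite lee_fin].
  by apply: (le_trans (sum_sqr_chernoff iX _ _)); [rewrite /k2; lra|rewrite lee_fin].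
apply/seteqP; split => w /=; rewrite ler_normr /c1 /c2 -!mulrA.
  rewrite ler_pM2l// ler_nM2l; last by rewrite /k2; lra.
  by move=> /orP[] ?; [right|left]; lra.
rewrite ler_pM2l// ler_nM2l; last by rewrite /k2; lra.
by move=> [] ?; apply/orP; [right|left]; lra.
Qed.

Lemma probability_bigcup_ord (R : realType) d (T : measurableType d)
    (P : probability T R) n (F : 'I_n -> set T) : (forall i, measurable (F i)) ->
  measurable (\bigcup_(i in [set: 'I_n]) F i) /\
  (P (\bigcup_(i in [set: 'I_n]) F i) <= \sum_(i < n) P (F i))%E.
Proof.
move=> mF; have mb : measurable (\bigcup_(i in [set: 'I_n]) F i).
  by apply: fin_bigcup_measurable.
split=> //.
have -> : \bigcup_(i in [set: 'I_n]) F i = \big[setU/set0]_(i < n) F i.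
  rewrite -bigcup_seq; apply/seteqP; split => x [i _ Fi]; exists i => //=.
  exact: mem_index_enum.
have [] : measurable (\big[setU/set0]_(i < n) F i) /\
    (P (\big[setU/set0]_(i < n) F i) <= \sum_(i < n) P (F i))%E; last by [].
elim/big_rec2: _ => [|i x y _ [my yx]]; first by rewrite measure0.
split; first exact: measurableU.
by apply: (le_trans (measureU2 _ (mF i) my)); rewrite leeD2l.
Qed.

Lemma spread_widen (R : realType) n (C C' z t t' : R) (A : 'M[R]_n) :
  C' <= C -> t <= t' -> spread C z t A -> spread C' z t' A.
Proof.
move=> CC tt [mu [charA mugap muz]]; exists mu; split=> // [i j ij|i].
  by have := mugap _ _ ij; lra.
by apply: lt_le_trans tt.
Qed.

Lemma measurable_gram (R : realType) d (T : measurableType d) m n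
    (V : T -> 'M[R]_(m, n)) : (forall i j, measurable_fun setT (fun w => V w i j)) ->
  forall i j, measurable_fun setT (fun w => ((V w)^T *m V w) i j).
Proof.
move=> mV i j; under eq_fun do rewrite mxE.
by apply: measurable_sum => k; under eq_fun do rewrite mxE; exact: measurable_funM.
Qed.

Lemma gram_row_mx (R : comPzRingType) m n (u : 'cV[R]_m) (V : 'M[R]_(m, n)) :
  (row_mx u V)^T *m row_mx u V =
  block_mx ((u^T *m u) 0 0)%:M (u^T *m V) (u^T *m V)^T (V^T *m V).
Proof. by rewrite tr_row_mx mul_col_row -mx11_scalar trmx_mul trmxK. Qed.

(** The estimate with [V] frozen. [E1] is the failure of |u|^2 to concentrate; [E2 i] and [E3 i] say
    that beta_i^2 is too small or too large. Off all of them [spread_bordered] applies with t = eta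
    N, and a union bound concludes. *)
Lemma probability_not_spread_bordered (R : realType) n p d (T : measurableType d)
    (P : probability T R) (U : 'I_p -> T -> R) (V : 'M[R]_(p, n))
    (C C' eta delta M e : R) (N := p%:R : R)
    (F := fun w => row_mx (\col_i U i w) V) :
  iid_normal P U -> spread C' N (eta * N) (V^T *m V) ->
  0 < N -> 0 < eta -> eta <= 2^-1 -> 0 < C -> C *+ 2 <= C' -> C <= eta * N ->
  n%:R * M < eta ^+ 2 * N -> n%:R * M <= eta * (C' - C) ->
  0 < delta -> eta * C *+ 4 <= delta ->
  (P [set w | (eta * N <= `|\sum_i U i w ^+ 2 - N|)%R] <= e%:E)%E ->
  (P [set w | ~ spread C N (eta * N *+ 2) ((F w)^T *m F w)] <=
   (e + n%:R * (expR (2^-1) * Num.sqrt (delta *+ 2) + 2 * expR (- (M / 8))))%:E)%E.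
Proof.
move=> iU [mu [charA mugap muz]] N0 eta0 eta2 C0 CC Cd nM nMC delta0 deltaC Pe.
have symA : (V^T *m V)^T = V^T *m V by rewrite trmx_mul trmxK.
have mu_inj : injective mu.
  move=> i j ij; apply/val_inj/eqP; rewrite -[_ == _]negbK neq_ltn negb_or.
  by apply/andP; split; apply/negP => /mugap; rewrite ij; lra.
have [Q QQ QA] := symmetric_eigenbasis symA mu_inj charA.
(* beta_i is the linear form in u with coefficient vector V y_i, of variance |V y_i|^2 = y_i . V^T V
   y_i = mu_i. *)
pose a i k := (V *m Q^T) k i.
have a2 i : \sum_k a i k ^+ 2 = mu i.
  have : (Q *m (V^T *m V) *m Q^T) i i = mu i.
    have -> : Q *m (V^T *m V) = diag_mx (\row_i mu i) *m Q.
      by apply/row_matrixP => k; rewrite !row_mul QA row_diag_mx -scalemxAl -rowE mxE.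
    by rewrite -mulmxA QQ mulmx1 !mxE eqxx.
  have QV : Q *m V^T = (V *m Q^T)^T by rewrite trmx_mul trmxK.
  rewrite !mulmxA QV -mulmxA mxE => <-.
  by apply: eq_bigr => k _; rewrite [_^T i k]mxE -expr2.
(* Since eta <= 1/2, the variances suit the small-ball bound with A = N / 2 and the tail bound with
   A = N. *)
have muN i : N / 2 <= mu i /\ mu i <= N *+ 2.
  have := muz i; rewrite ltr_norml => /andP[].
  have : eta * N <= 2^-1 * N by rewrite ler_pM2r.
  by move=> ? ? ?; split; lra.
pose L i w := \sum_k a i k * U k w.
pose E1 := [set w | eta * N <= `|\sum_i U i w ^+ 2 - N|].
pose E2 i := [set w | L i w ^+ 2 <= delta * N].
pose E3 i := [set w | M * N <= L i w ^+ 2].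
have [mU _] := iU.
have mE1 : measurable E1.
  rewrite -[X in measurable X]setTI.
  have : measurable_fun setT (fun w => `|\sum_i U i w ^+ 2 - N|).
    apply: measurableT_comp => //; apply: measurable_funB => //.
    by apply: measurable_sum => i; exact: measurable_funX.
  by move=> /(_ measurableT `[eta * N, +oo[%classic (measurable_itv _)); rewrite preimage_itvcy.
have mE2 i : measurable (E2 i) by exact: (measurable_lin_sqr_le iU).
have mE3 i : measurable (E3 i) by exact: (measurable_lin_sqr_ge iU).
have [mE PE] := probability_bigcup_ord P (fun i => measurableU _ _ (mE2 i) (mE3 i)).
have sub : [set w | ~ spread C N (eta * N *+ 2) ((F w)^T *m F w)] `<=`
    E1 `|` \bigcup_(i in [set: 'I_n]) (E2 i `|` E3 i).
  move=> w /= nspread; have [?|/negP] := pselect (E1 w); first by left.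
  rewrite -ltNge => nE1; right; apply: contrapT => nE; apply: nspread.
  have nE2 i : delta * N < L i w ^+ 2.
    by rewrite ltNge; apply/negP => h; apply: nE; exists i => //; left.
  have nE3 i : L i w ^+ 2 < M * N.
    by rewrite ltNge; apply/negP => h; apply: nE; exists i => //; right.
  rewrite /F gram_row_mx.
  set u := \col_i U i w.
  have LE i : (u^T *m V *m Q^T) 0 i = L i w.
    by rewrite -mulmxA mxE; apply: eq_bigr => k _; rewrite [u^T 0 k]mxE [u k 0]mxE mulrC.
  have sL : \sum_i L i w ^+ 2 <= n%:R * M * N.
    rewrite -mulrA mulr_natl -[n in leRHS]card_ord -sumr_const.
    by apply: ler_sum => i _; exact: ltW.
  apply: (@spread_bordered _ _ _ Q mu _ _ _ C') => //.
  - have -> : (u^T *m u) 0 0 = \sum_i U i w ^+ 2.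
      by rewrite mxE; apply: eq_bigr => k _; rewrite !mxE expr2.
    exact: ltW.
  - under eq_bigr do rewrite LE; apply: (le_lt_trans sL).
    by rewrite exprMn [N ^+ 2]expr2 mulrA ltr_pM2r.
  - under eq_bigr do rewrite LE; apply: (le_trans sL).
    by rewrite [leRHS]mulrAC ler_pM2r.
  - move=> i; rewrite LE; apply: le_lt_trans (nE2 i).
    by rewrite mulrAC -mulrnAl ler_pM2r.
have mbad : measurable [set w | ~ spread C N (eta * N *+ 2) ((F w)^T *m F w)].
  apply: measurableC; apply: measurable_spread; first exact: ltW.
  apply: measurable_gram => i j; rewrite /F.
  case: (split_ordP j) => k ->; first by under eq_fun do rewrite row_mxEl mxE; exact: mU.
  by under eq_fun do rewrite row_mxEr; exact: measurable_cst.
apply: (@le_trans _ _ (P (E1 `|` \bigcup_(i in [set: 'I_n]) (E2 i `|` E3 i)))).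
  by apply: le_measure => //; rewrite inE//; exact: measurableU.
apply: (le_trans (measureU2 _ mE1 mE)); rewrite EFinD leeD//.
apply: (le_trans PE).
rewrite mulr_natl -[n in leRHS]card_ord -sumr_const -sumEFin.
apply: lee_sum => i _; apply: (le_trans (measureU2 _ (mE2 i) (mE3 i))).
rewrite EFinD leeD//; have [mu1 mu2] := muN i.
  have : delta *+ 2 = delta * N / (N / 2) by field; rewrite gt_eqF.
  move=> ->; apply: (lin_sqr_small_ball iU); rewrite ?a2// ?mulr_gt0//.
by apply: (lin_sqr_tail iU) => //; rewrite a2.
Qed.

Lemma exists_nat_mul_ge (R : realType) (eta c : R) : 0 < eta ->
  exists D, forall n, (D <= n)%N -> c < eta * n%:R.
Proof.
move=> eta0; exists (Num.trunc (`|c| / eta)).+1 => n Dn.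
rewrite mulrC -ltr_pdivrMr//; apply: (@le_lt_trans _ _ (`|c| / eta)).
  by rewrite ler_pM2r ?invr_gt0// ler_norm.
by apply: (lt_le_trans (truncnS_gt _)); rewrite ler_nat.
Qed.

(** Induction on the number of columns. C and eta are general because the step calls the hypothesis
    with a larger separation [C'] and a smaller relative radius [h]. *)
Lemma spread_gram_eventually (R : realType) n (C eta e : R) :
  0 < C -> 0 < eta -> 0 < e ->
  exists D, forall p, (D <= p)%N ->
    forall d (T : measurableType d) (P : probability T R)
      (X : 'I_p * 'I_n -> T -> R) (V := fun w => \matrix_(i, j) X (i, j) w),
    iid_normal P X ->
    (P [set w | ~ spread C p%:R (eta * p%:R) ((V w)^T *m V w)] <= e%:E)%E.
Proof.
elim: n C eta e => [|n IH] C eta e C0 eta0 e0.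
  exists 1%N => p p0 d T P X V iX.
  rewrite (_ : [set w | _] = set0) ?measure0 ?lee_fin ?ltW//.
  apply/seteqP; split=> w //=; apply.
  exists (fun=> 0); split; [|by case|by case].
  by rewrite big_ord0 /char_poly det_mx00.
(* One third of e goes to the spectrum of V^T V, one to |u|^2 and one to the beta_i, each of which
   costs at most 2 e1. *)
pose e1 := e / (6 * n.+1%:R).
have n1 : 0 < n.+1%:R :> R by rewrite ltr0n.
have e10 : 0 < e1 by rewrite divr_gt0// mulr_gt0.
(* [delta] makes the small-ball bound equal to e1; [M] makes the tail bound at most e1, by exp x >=
   1 + x at x = 2 / e1. *)
pose delta := (e1 / expR (2^-1)) ^+ 2 / 2.
have delta0 : 0 < delta by rewrite divr_gt0// exprn_gt0// divr_gt0// expR_gt0.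
pose M := 16 / e1.
have M0 : 0 < M by rewrite divr_gt0.
have tail_le : n%:R * (expR (2^-1) * Num.sqrt (delta *+ 2) + 2 * expR (- (M / 8))) <= e / 3.
  have -> : delta *+ 2 = (e1 / expR (2^-1)) ^+ 2 by rewrite -mulr_natr /delta divfK.
  rewrite sqrtr_sqr ger0_norm; last by rewrite divr_ge0 ?expR_ge0 ?ltW.
  rewrite [expR _ * _]mulrC divfK ?gt_eqF ?expR_gt0//.
  have : 2 * expR (- (M / 8)) <= e1.
    have M8 : M / 8 = 2 / e1 by rewrite /M; field; rewrite gt_eqF.
    rewrite expRN M8 ler_pdivrMr ?expR_gt0// -ler_pdivrMl//.
    by have := expR_ge1Dx (2 / e1); rewrite mulrC; lra.
  move=> h; apply: (@le_trans _ _ (n.+1%:R * (e1 + e1))).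
    apply: ler_pM; rewrite ?ler0n ?ler_nat ?leqnSn ?lerD2l//.
    by rewrite addr_ge0 ?mulr_ge0 ?expR_ge0 ?ltW.
  have -> : n.+1%:R * (e1 + e1) = e / 3 by rewrite /e1; field; rewrite gt_eqF.
  by [].
(* 2h <= eta because bordering doubles the radius, h <= 1/2 controls the variances, and 4hC <= delta
   lets the nearest pole dominate. *)
pose h := Num.min (eta / 2) (Num.min (2^-1) (delta / (4 * C))).
have h0 : 0 < h.
  by rewrite !lt_min; apply/and3P; split; rewrite ?invr_gt0 ?divr_gt0 ?mulr_gt0.
have h_eta : h *+ 2 <= eta.
  have : h <= eta / 2 by rewrite ge_min lexx.
  lra.
have h_2 : h <= 2^-1 by rewrite !ge_min lexx orbT.
have h_delta : h * C *+ 4 <= delta.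
  have : h <= delta / (4 * C) by rewrite !ge_min lexx !orbT.
  by rewrite ler_pdivlMr ?mulr_gt0//; lra.
(* Chosen so that C' >= 2C and h (C' - C) >= n M, which bounds the effect of the remote poles. *)
pose C' := C *+ 2 + n%:R * M / h.
have nM0 : 0 <= n%:R * M by rewrite mulr_ge0 ?ler0n ?(ltW M0).
have nMh : 0 <= n%:R * M / h by rewrite divr_ge0 ?(ltW h0).
have C'0 : 0 < C' by rewrite /C'; lra.
have e3 : 0 < e / 3 by rewrite divr_gt0.
have [D1 D1P] := IH C' h (e / 3) C'0 h0 e3.
have h_1 : h < 1 by lra.
have [D2 D2P] := sum_sqr_concentration h0 h_1 e3.
have [D3 D3P] := exists_nat_mul_ge C h0.
have h2 : 0 < h ^+ 2 by rewrite exprn_gt0.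
have [D4 D4P] := exists_nat_mul_ge (n%:R * M) h2.
exists (maxn (maxn D1 D2) (maxn (maxn D3 D4) 1)) => p.
rewrite !geq_max => /andP[/andP[/D1P{}D1P /D2P{}D2P] /andP[/andP[/D3P{}D3P /D4P{}D4P] p0]].
move=> d T P X V iX.
have N0 : 0 < p%:R :> R by rewrite ltr0n.
pose U i w := X (i, ord0) w.
have iU : iid_normal P U by apply: (iid_normal_inj _ iX) => i j [].
(* [rshift 1] skips column 0, which is the fresh column [U]. *)
pose X' (ij : 'I_p * 'I_n) := X (ij.1, rshift 1 ij.2).
have iX' : iid_normal P X'.
  by apply: (iid_normal_inj _ iX) => -[i j] [k l] [-> jl]; congr (_, _); exact: val_inj.
have [mX _] := iX.
pose J : pred ('I_p * 'I_n.+1) := fun ij => ij.2 != ord0.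
pose S1 := g_sigma_algebraType (block X J).
pose S2 := g_sigma_algebraType (block X (predC J)).
(* The old columns are read at w and the fresh one at w', ready for [integral_block]. *)
pose G w w' : 'M[R]_(p, 1 + n) :=
  row_mx (\col_i U i w') (\matrix_(i, j) X' (i, j) w).
have GE w : V w = G w w.
  apply/(@matrixP R p (1 + n) (V w) (G w w)) => i j; rewrite /G.
  case: (@split_ordP 1 n j) => k ->.
    rewrite row_mxEl !mxE /U; congr (X (_, _) w); apply: val_inj.
    by rewrite /= (ord1 k).
  by rewrite row_mxEr !mxE.
pose bad w w' := ~ spread C p%:R (eta * p%:R) ((G w w')^T *m G w w').
(* Measurability of the bad event is needed on the product of the two sub-sigma-algebras for the
   decoupling, on sections for the inner probability, on T * T for the outer integral, and on the
   diagonal. *)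
have mbad : measurable [set w : S1 * S2 | bad w.1 w.2].
  apply: measurableC; apply: measurable_spread; first exact: ltW.
  apply: measurable_gram => i j; rewrite /G; case: (@split_ordP 1 n j) => k ->.
    under eq_fun do rewrite row_mxEl mxE; exact: measurable_block_snd.
  by under eq_fun do rewrite row_mxEr mxE; exact: measurable_block_fst.
have mbadw w : measurable [set w' : T | bad w w'].
  apply: measurableC; apply: measurable_spread; first exact: ltW.
  apply: measurable_gram => i j; rewrite /G; case: (@split_ordP 1 n j) => k ->.
    by under eq_fun do rewrite row_mxEl mxE; exact: mX.
  by under eq_fun do rewrite row_mxEr; exact: measurable_cst.
have mbad2 : measurable [set w : T * T | bad w.1 w.2].
  apply: measurableC; apply: measurable_spread; first exact: ltW.
  apply: measurable_gram => i j; rewrite /G; case: (@split_ordP 1 n j) => k ->.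
    by under eq_fun do rewrite row_mxEl mxE; exact: measurableT_comp (mX _) measurable_snd.
  by under eq_fun do rewrite row_mxEr mxE; exact: measurableT_comp (mX _) measurable_fst.
have mbadT : measurable [set w : T | bad w w].
  apply: measurableC; apply: measurable_spread; first exact: ltW.
  apply: measurable_gram => i j; rewrite /G; case: (@split_ordP 1 n j) => k ->.
    by under eq_fun do rewrite row_mxEl mxE; exact: mX.
  by under eq_fun do rewrite row_mxEr mxE; exact: mX.
pose V' w : 'M[R]_(p, n) := \matrix_(i, j) X' (i, j) w.
pose B' := [set w | ~ spread C' p%:R (h * p%:R) ((V' w)^T *m V' w)].
have mB' : measurable B'.
  apply: measurableC; apply: measurable_spread; first exact: ltW.
  by apply: measurable_gram => i j; under eq_fun do rewrite mxE; exact: mX.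
have PB' : (P B' <= (e / 3)%:E)%E by exact: D1P iX'.
rewrite (_ : [set w | _] = [set w | bad w w]); last first.
  by apply/seteqP; split => w /=; rewrite /bad GE.
pose f (w : S1 * S2) := ((\1_[set w : S1 * S2 | bad w.1 w.2] w : R)%:E).
have -> : P [set w | bad w w] = (\int[P]_w f (w, w))%E.
  have -> : P [set w | bad w w] = (\int[P]_w (\1_[set w | bad w w] w)%:E)%E.
    by rewrite integral_indic// setIT.
  by apply: eq_integral => w _; rewrite /f !indicE; congr (_%:R%:E).
rewrite (integral_block iX); last 2 first.
- by apply/measurable_EFinP; exact: measurable_indic.
- by move=> w; rewrite lee_fin indicE.
have inner w : (\int[P]_w' f (w, w'))%E = P [set w' | bad w w'].
  have -> : P [set w' | bad w w'] = (\int[P]_w' (\1_[set w' | bad w w'] w')%:E)%E.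
    by rewrite integral_indic ?setIT.
  by apply: eq_integral => w' _; rewrite /f !indicE; congr (_%:R%:E).
have PG w : ~ B' w -> (P [set w' | bad w w'] <= (e / 3 + e / 3)%:E)%E.
  move=> /contrapT gw.
  have := @probability_not_spread_bordered _ _ _ _ _ P U (V' w) C C' h delta M (e / 3)
    iU gw N0 h0 h_2 C0.
  move=> /(_ _ _ _ _ delta0 h_delta (D2P _ _ _ _ iU)) step.
  apply: (@le_trans _ _ (P [set w' | ~ spread C p%:R (h * p%:R *+ 2)
       ((row_mx (\col_i U i w') (V' w))^T *m row_mx (\col_i U i w') (V' w))])).
    apply: le_measure; rewrite ?inE//.
      apply: measurableC; apply: measurable_spread; first exact: ltW.
      apply: measurable_gram => i j; case: (@split_ordP 1 n j) => k ->.
        by under eq_fun do rewrite row_mxEl mxE; exact: mX.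
      by under eq_fun do rewrite row_mxEr; exact: measurable_cst.
    move=> w' /= bw sp; apply: bw; apply: spread_widen sp => //.
    by rewrite -mulrnAl ler_pM2r.
  apply: le_trans; first apply: step.
  - by rewrite /C'; lra.
  - exact: ltW.
  - exact: D4P.
  - have -> : h * (C' - C) = h * C + n%:R * M.
      by rewrite /C'; field; rewrite gt_eqF.
    by rewrite lerDr mulr_ge0// ltW.
  - by rewrite lee_fin lerD2l.
(* The conditional probability is at most 2e/3 off [B'] and at most 1 on [B'], whose probability is
   at most e/3. *)
apply: (@le_trans _ _ (\int[P]_w ((e / 3 + e / 3)%:E + (\1_B' w)%:E))%E).
  apply: ge0_le_integral => //.
  - by move=> w _; rewrite inner.
  - apply: (measurable_fun_fubini_tonelli_F (m2 := P)
      (fun w : T * T => (\1_[set w : T * T | bad w.1 w.2] w : R)%:E)).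
      by apply/measurable_EFinP; exact: measurable_indic.
    by move=> w; rewrite lee_fin indicE.
  - apply: emeasurable_funD => //; apply/measurable_EFinP; exact: measurable_indic.
  - move=> w _; rewrite inner indicE; have [Bw|nBw] := boolP (w \in B').
      apply: (le_trans (probability_le1 _ _)) => //.
      by rewrite -EFinD lee_fin mulr1n; lra.
    rewrite adde0; apply: PG => Bw; move/negP: nBw; apply; exact/mem_set.
rewrite ge0_integralD; last 5 first.
- exact: measurableT.
- by move=> w _; rewrite lee_fin addr_ge0 ?ltW.
- exact: measurable_cst.
- by move=> w _; rewrite lee_fin indicE.
- by apply/measurable_EFinP; exact: measurable_indic.
rewrite (integral_cst P measurableT (e / 3 + e / 3)%:E).
rewrite [X in (_ * X)%E]probability_setT mule1 integral_indic// setIT.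
have -> : e%:E = ((e / 3 + e / 3)%:E + (e / 3)%:E)%E by rewrite -EFinD; congr (_%:E); lra.
by rewrite leeD2l.
Qed.

(** * From Wishart matrices to Gaussian data *)

(** A box of scalar events is a box of vector events [S i]: independence of the vectors splits it
    over i, then independence of the coordinates splits each factor over j. *)
Lemma wishart_columns_iid (R : realType) (d : measure_display) (T : measurableType d)
    (P : probability T R) (m n : nat) (v : 'I_n -> {RV P >-> 'cV[R]_m}) :
  mutually_independent P v -> (forall i, std_gaussian_vector (v i)) ->
  iid_normal P (fun (ij : 'I_n * 'I_m) w => v ij.1 w ij.2 0).
Proof.
move=> v_indep v_gauss; split=> [[i j]|B mB] /=.
  exact: measurableT_comp (measurable_mx_entry j 0) (measurable_funPT (v i)).
pose S i := \bigcap_(j in [set: 'I_m]) [set x : 'cV[R]_m | B (i, j) (x j 0)].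
have mS i : measurable (S i).
  apply: fin_bigcap_measurable => // j _; rewrite -[X in measurable X]setTI.
  exact: (@measurable_mx_entry R m 1 j 0).
have := v_indep S mS.
rewrite (_ : \bigcap_(i in [set: 'I_n]) _ =
    \bigcap_(ij in [set: 'I_n * 'I_m]) (fun w => v ij.1 w ij.2 0) @^-1` B ij); last first.
  apply/seteqP; split => w /= h; first by move=> [i j] _; exact: (h i Logic.I j Logic.I).
  by move=> i _ j _; exact: (h (i, j) Logic.I).
move=> ->; rewrite [RHS](eq_bigr (fun ij => normal_prob 0 1 (B (ij.1, ij.2)))); last by case.
rewrite -(pair_bigA _ (fun i j => normal_prob 0 1 (B (i, j)))) /=.
apply: eq_bigr => i _; have [vi_indep vi_normal] := v_gauss i.
have := vi_indep (fun j => B (i, j)) (fun j => mB (i, j)).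
rewrite (_ : \bigcap_(j in [set: 'I_m]) _ = v i @^-1` S i); last first.
  by apply/seteqP; split => w /= h j _; exact: (h j Logic.I).
by move=> ->; apply: eq_bigr => j _; exact: vi_normal.
Qed.

Theorem theorem4p11 (R : realType) (m : nat) (hm : (2 <= m)%N)
    (disp : nat -> measure_display) (T : forall d : nat, measurableType (disp d))
    (P : forall d : nat, probability (T d) R)
    (W : forall d : nat, {RV (P d) >-> 'M[R]_m})
    (hW : forall d : nat, std_wishart d (W d))
    (C : R) (hC : 0 < C) :
  (fun d : nat => P d [set w : T d | C < min_gap (W d w)]) @ \oo --> 1%:E.
Proof.
have mG : measurable [set A : 'M[R]_m | C < min_gap A].
  by apply: measurable_min_gap_gt => // i j; exact: measurable_mx_entry.
apply/fine_cvgP; split.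
  near=> d; rewrite fin_num_measure// -[X in measurable X]setTI.
  exact: (measurable_funPT (W d) measurableT _ mG).
apply/cvgrPdist_le => e e0 /=.
(* Only the separation matters here, so the radius d given by eta = 1 suffices. *)
have [D DP] := @spread_gram_eventually R m C 1 e hC ltr01 e0.
exists D => // d /= /DP{}DP.
have [d' [T' [P' [v [v_indep v_gauss WE]]]]] := hW d.
(* The Gram representation holds in law, on another probability space; [mG] allows the event to be
   transferred. *)
have -> : P d [set w | C < min_gap (W d w)] =
    P' [set w | C < min_gap (\sum_(i < d) v i w *m (v i w)^T)] by exact: (WE _ mG).
have iX := wishart_columns_iid v_indep v_gauss.
pose V w : 'M[R]_(d, m) := \matrix_(i, j) v i w j 0.
pose S := [set w | ~ spread C d%:R d%:R ((V w)^T *m V w)].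
have PS : (P' S <= e%:E)%E by have := DP _ _ _ _ iX; rewrite mul1r.
have VE w : \sum_(i < d) v i w *m (v i w)^T = (V w)^T *m V w.
  apply/matrixP => j k; rewrite summxE mxE; apply: eq_bigr => i _.
  by rewrite mxE big_ord1 !mxE.
have mV i j : measurable_fun setT (fun w => V w i j).
  by case: iX => mX _; under eq_fun do rewrite mxE; exact: (mX (i, j)).
have mS : measurable S.
  apply: measurableC; apply: measurable_spread; first exact: ltW.
  exact: measurable_gram.
set E := [set w | _ < _].
have mE : measurable E.
  rewrite /E; under eq_fun do rewrite VE.
  by apply: measurable_min_gap_gt => //; exact: measurable_gram.
have SE : ~` S `<=` E.
  move=> w /contrapT [mu [charG mugap muz]]; rewrite /E /= VE.
  (* |mu_i - d| < d places the eigenvalues within 2d of 0. *)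
  apply/(min_gap_gtP _ hC hm); exists (2 * d)%N, mu; split => // i.
  have := muz i; rewrite subr0 natrM !ltr_norml => /andP[? ?].
  have d0 : 0 <= d%:R :> R by rewrite ler0n.
  by apply/andP; split; lra.
have PE : ((1 - e)%:E <= P' E)%E.
  apply: (@le_trans _ _ (P' (~` S))); last first.
    by apply: le_measure; rewrite ?inE//; exact: measurableC.
  by rewrite probability_setC// EFinB leeB.
have PE1 : (P' E <= 1)%E by exact: probability_le1.
have PEfin : P' E \is a fin_num by exact: fin_num_measure.
move: PE PE1; rewrite -(fineK PEfin) !lee_fin => ? ?.
by rewrite ger0_norm; lra.
Unshelve. all: by end_near.
Qed.
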